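(* Let $\widetilde M^2_1(4c)$ be a complex pseudo space form of complex dimension $2$ and complex index $1$, and let $M=M^2_1$ be a Lagrangian, Lorentzian surface in $\widetilde M^2_1(4c)$. Then $M$ is pseudo-isotropic if and only if $M$ is minimal.
   Context: A complex pseudo space form $\widetilde M^2_1(4c)$ is an indefinite Kähler manifold of complex dimension $2$, with complex structure $J$ and metric $\langle\cdot,\cdot\rangle$ of complex index $1$ (so real dimension $4$ and real index $2$), of constant holomorphic sectional curvature $4c$. A Lagrangian, Lorentzian surface $M^2_1$ is an immersed real surface whose induced metric has signature $(1,1)$ and such that $J$ interchanges the tangent and the normal spaces of $M$. The second fundamental form $h$ is defined by $\widetilde\nabla_XY=\nabla_XY+h(X,Y)$, where $\widetilde\nabla$ and $\nabla$ are the Levi-Civita connections of the ambient space and of $M$. The surface is minimal if the trace of $h$ with respect to the induced metric vanishes identically (equivalently $h(e_1,e_2)=0$ for every null frame, i.e. every tangent basis with $\langle e_1,e_1\rangle=\langle e_2,e_2\rangle=0$, $\langle e_1,e_2\rangle=1$). $M$ is called pseudo-isotropic if there is a smooth function $\widetilde\lambda$ on $M$ such that $\langle h(v,v),h(v,v)\rangle=\widetilde\lambda(p)\langle v,v\rangle^2$ for every $p\in M$ and every $v\in T_pM$. *)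

(* Defs.v *)
From HB Require Import structures.
From mathcomp Require Import all_boot all_order all_algebra.
From mathcomp Require Import all_classical all_reals all_analysis.
Set Implicit Arguments.
Unset Strict Implicit.
Unset Printing Implicit Defensive.
Import Order.TTheory GRing.Theory Num.Theory.
Import numFieldNormedType.Exports.
Local Open Scope classical_set_scope.
Local Open Scope ring_scope.

(** * Smooth functions on open sets *)

(* Only meaningful for [U] open. *)
Fixpoint Ck_on (R : realType) (V W : normedModType R) (U : set V)
    (k : nat) (f : V -> W) : Prop :=
  match k with
  | 0 => forall x, U x -> {for x, continuous f}
  | k'.+1 => (forall x, U x -> differentiable f x) /\
             (forall v : V, Ck_on U k' ('D_v f))
  end.

Definition smooth_on (R : realType) (V W : normedModType R) (U : set V)
    (f : V -> W) : Prop :=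
  forall k, Ck_on U k f.

(** * Smooth manifolds *)

(* A homeomorphism [coord] from an open set [dom] of [M] onto an open set of
   R^n; [coord] and its inverse [param] are total functions, whose values
   outside [dom] and [coord @` dom] are irrelevant. *)
Record chart (R : realType) (M : topologicalType) (n : nat) := Chart {
  dom : set M;
  coord : M -> 'rV[R]_n;
  param : 'rV[R]_n -> M;
  dom_open : open dom;
  cod_open : open (coord @` dom);
  coord_continuous : forall p, dom p -> {for p, continuous coord};
  param_continuous : forall u, (coord @` dom) u -> {for u, continuous param};
  coordK : forall p, dom p -> param (coord p) = p }.

Definition cod (R : realType) (M : topologicalType) n (c : chart R M n) :
    set 'rV[R]_n :=
  coord c @` dom c.

(* The expression of [f : M -> N] in the charts [c] and [d], and its domain.
   For [f = id] these are the transition maps. *)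
Definition rep (R : realType) (M N : topologicalType) m n (f : M -> N)
    (c : chart R M m) (d : chart R N n) : 'rV[R]_m -> 'rV[R]_n :=
  fun u => coord d (f (param c u)).

Definition repdom (R : realType) (M N : topologicalType) m n (f : M -> N)
    (c : chart R M m) (d : chart R N n) : set 'rV[R]_m :=
  coord c @` (dom c `&` f @^-1` dom d).

Record manifold (R : realType) (n : nat) := Manifold {
  carrier :> topologicalType;
  carrier_hausdorff : hausdorff_space carrier;
  carrier_second_countable : @second_countable carrier;
  atlas : set (chart R carrier n);
  atlas_cover : forall p : carrier, exists2 c, atlas c & dom c p;
  atlas_compatible : forall c d, atlas c -> atlas d ->
    smooth_on (repdom (@idfun carrier) c d) (rep (@idfun carrier) c d) }.

Arguments atlas {R n} M : rename.

Definition smooth_map (R : realType) m n (M : manifold R m) (N : manifold R n)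
    (f : M -> N) : Prop :=
  continuous f /\
  (forall c d, atlas M c -> atlas N d ->
     smooth_on (repdom f c d) (rep f c d)).

Definition smooth_scalar (R : realType) n (M : manifold R n) (f : M -> R) :
    Prop :=
  forall c, atlas M c ->
    smooth_on (cod c) ((fun u => f (param c u)) : 'rV[R]_n -> R^o).

(** * Pseudo-Riemannian metrics *)

(* Tangent vectors are given by their components in a chart, as row vectors;
   a linear map with matrix [A] sends [v] to [v *m A], and a bilinear form with
   Gram matrix [G] is [inner G].  Tensor fields are families of matrix-valued
   functions of the coordinates, one for each chart of the atlas, obeying the
   transformation law. *)
Definition inner (R : realType) n (G : 'M[R]_n) (v w : 'rV[R]_n) : R :=
  (v *m G *m w^T) 0 0.

(* There is a basis (the rows of [P]) in which the form is
   diag(-1, .., -1, 1, .., 1) with [s] entries -1. *)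
Definition form_of_index (R : realType) n (s : nat) (G : 'M[R]_n) : Prop :=
  G^T = G /\
  exists2 P : 'M[R]_n, P \in unitmx &
    P *m G *m P^T = diag_mx (\row_(j < n) (if (j < s)%N then -1 else 1)).

Record metric (R : realType) n (M : manifold R n) (s : nat) := Metric {
  gram :> chart R M n -> 'rV[R]_n -> 'M[R]_n;
  gram_smooth : forall c, atlas M c -> smooth_on (cod c) (gram c);
  gram_index : forall c u, atlas M c -> cod c u ->
    form_of_index s (gram c u);
  gram_tensor : forall c d u, atlas M c -> atlas M d ->
    repdom (@idfun M) c d u ->
    let D := jacobian (rep (@idfun M) c d) u in
    gram c u = D *m gram d (rep (@idfun M) c d u) *m D^T }.

(** * Levi-Civita connection and curvature in a chart *)

(* [christoffel G u i j] is the vector with k-th component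
   Gamma^k_(i j) = 1/2 sum_l g^(k l) (d_i g_(j l) + d_j g_(i l) - d_l g_(i j)),
   that is, nabla_(d_i) d_j. *)
Definition christoffel (R : realType) n (G : 'rV[R]_n -> 'M[R]_n)
    (u : 'rV[R]_n) (i j : 'I_n) : 'rV[R]_n :=
  let pd (k : 'I_n) (f : 'rV[R]_n -> R^o) : R :=
    'D_(delta_mx 0 k) f u in
  \row_k (2^-1 * \sum_l invmx (G u) k l *
    (pd i (fun x => G x j l) + pd j (fun x => G x i l)
     - pd l (fun x => G x i j))).

(* The covariant derivative, in the direction [v] at [u], of the vector field
   [Y] along the map [F] into a chart with Gram matrix [G]. *)
Definition cov_along (R : realType) m n (G : 'rV[R]_n -> 'M[R]_n)
    (F Y : 'rV[R]_m -> 'rV[R]_n) (v u : 'rV[R]_m) : 'rV[R]_n :=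
  'D_v Y u +
  \sum_i \sum_j (('D_v F u) 0 i * Y u 0 j) *: christoffel G (F u) i j.

Definition cov (R : realType) n (G : 'rV[R]_n -> 'M[R]_n)
    (Y : 'rV[R]_n -> 'rV[R]_n) (v u : 'rV[R]_n) : 'rV[R]_n :=
  cov_along G idfun Y v u.

(* R(v, w) z = nabla_v nabla_w z - nabla_w nabla_v z, the vectors being extended
   to fields with constant components, so that [v, w] = 0. *)
Definition riemann (R : realType) n (G : 'rV[R]_n -> 'M[R]_n)
    (u v w z : 'rV[R]_n) : 'rV[R]_n :=
  cov G (cov G (cst z) w) v u - cov G (cov G (cst z) v) w u.

Definition sectional (R : realType) n (G : 'rV[R]_n -> 'M[R]_n)
    (u v w : 'rV[R]_n) : R :=
  inner (G u) (riemann G u v w w) v /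
  (inner (G u) v v * inner (G u) w w - inner (G u) v w ^+ 2).

(** * Indefinite Kaehler manifolds and complex pseudo space forms *)

(* [n] and [s] are the real dimension and the real index, twice the complex
   ones.  [cplx_parallel] is (nabla_v J) w = nabla_v (J w) - J (nabla_v w) = 0
   for [w] extended with constant components; since nabla is torsion-free it
   entails the integrability of J. *)
Record kahler (R : realType) n (N : manifold R n) s (g : metric N s) :=
  Kahler {
  cplx :> chart R N n -> 'rV[R]_n -> 'M[R]_n;
  cplx_smooth : forall c, atlas N c -> smooth_on (cod c) (cplx c);
  cplx_tensor : forall c d u, atlas N c -> atlas N d ->
    repdom (@idfun N) c d u ->
    let D := jacobian (rep (@idfun N) c d) u in
    cplx c u *m D = D *m cplx d (rep (@idfun N) c d u);
  cplx_square : forall c u, atlas N c -> cod c u ->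
    cplx c u *m cplx c u = - 1%:M;
  cplx_isometry : forall c u, atlas N c -> cod c u ->
    forall v w, inner (g c u) (v *m cplx c u) (w *m cplx c u)
                = inner (g c u) v w;
  cplx_parallel : forall c u, atlas N c -> cod c u ->
    forall v w : 'rV[R]_n,
      cov (g c) (fun x => w *m cplx c x) v u
      = cov (g c) (cst w) v u *m cplx c u }.

Definition constant_holomorphic_curvature (R : realType) n (N : manifold R n)
    s (g : metric N s) (J : kahler g) (k : R) : Prop :=
  forall c u, atlas N c -> cod c u ->
    forall v, inner (g c u) v v != 0 ->
      sectional (g c) u v (v *m J c u) = k.

(* The complex dimension is [n] and the complex index is [s]. *)
Record complex_pseudo_space_form (R : realType) (n s : nat) (k : R) :=
  ComplexPseudoSpaceForm {
  csf_manifold :> manifold R n.*2;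
  csf_metric : metric csf_manifold s.*2;
  csf_cplx : kahler csf_metric;
  csf_curvature : constant_holomorphic_curvature csf_cplx k }.

(** * Submanifolds *)

Definition isometric_immersion (R : realType) m n
    (M : manifold R m) s (gM : metric M s)
    (N : manifold R n) t (g : metric N t) (f : M -> N) : Prop :=
  smooth_map f /\
  forall c d u, atlas M c -> atlas N d -> repdom f c d u ->
    let D := jacobian (rep f c d) u in
    row_free D /\ gM c u = D *m g d (rep f c d u) *m D^T.

(* The tangent space is the row space of the Jacobian matrix and the normal
   space is its orthogonal complement. *)
Definition lagrangian (R : realType) m n (M : manifold R m)
    (N : manifold R n) t (g : metric N t) (J : kahler g) (f : M -> N) : Prop :=
  forall c d u, atlas M c -> atlas N d -> repdom f c d u ->
    let T := jacobian (rep f c d) u in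
    let x := rep f c d u in
    let normal := kermx (g d x *m T^T) in
    (T *m J d x == normal)%MS /\ (normal *m J d x == T)%MS.

(* h(v, w) = nabla~_v (f_* w) - f_* (nabla_v w), with [w] extended to the field
   with constant components in the chart [c]. *)
Definition second_fundamental_form (R : realType) m n
    (M : manifold R m) s (gM : metric M s)
    (N : manifold R n) t (g : metric N t) (f : M -> N)
    (c : chart R M m) (d : chart R N n) (u v w : 'rV[R]_m) : 'rV[R]_n :=
  let F := rep f c d in
  cov_along (g d) F ('D_w F) v u - cov (gM c) (cst w) v u *m jacobian F u.

Definition minimal (R : realType) m n (M : manifold R m) s (gM : metric M s)
    (N : manifold R n) t (g : metric N t) (f : M -> N) : Prop :=
  forall c d u, atlas M c -> atlas N d -> repdom f c d u ->
    \sum_i \sum_j invmx (gM c u) i j *: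
      second_fundamental_form gM g f c d u (delta_mx 0 i) (delta_mx 0 j) = 0.

Definition pseudo_isotropic (R : realType) m n
    (M : manifold R m) s (gM : metric M s)
    (N : manifold R n) t (g : metric N t) (f : M -> N) : Prop :=
  exists2 lambda : M -> R, smooth_scalar lambda &
    forall c d u, atlas M c -> atlas N d -> repdom f c d u ->
      forall v, let hvv := second_fundamental_form gM g f c d u v v in
        inner (g d (rep f c d u)) hvv hvv
        = lambda (param c u) * inner (gM c u) v v ^+ 2.

(* Main.v *)
(** The cubic form [C(v, w, z) = <h(v, w), J z>] of a Lagrangian submanifold is
    totally symmetric: [h] is symmetric because the connections are torsion-free,
    and [<h(v, w), J z> = <h(v, z), J w>] follows by differentiating
    [<w, J z> = 0] along [v], [J] being parallel and skew.  As [J] maps the tangent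
    plane onto the normal plane, in a basis [p0], [p1] of the tangent plane with
    [<p0, p0> = -1], [<p1, p1> = 1], [<p0, p1> = 0] one has
    [<h(v, v), h(v, v)> = - C(v, v, p0)^2 + C(v, v, p1)^2].  This quartic form in [v]
    is a multiple of [<v, v>^2] if and only if the coefficients of [C] on
    [e1, e1, e2] and [e1, e2, e2] vanish for [e1 = p0 + p1] and [e2 = p1 - p0],
    that is, [h(e1, e2) = h(p1, p1) - h(p0, p0) = 0].

    This equivalence is pointwise, but the factor obtained from minimality has to be
    a smooth function on the surface: it does not depend on the charts since the
    second fundamental form of a local isometry is zero, and near any point it is
    the quotient of [<h(v, v), h(v, v)>] by [<v, v>^2] for a fixed non-null [v]. *)

From mathcomp Require Import all_boot all_order all_algebra.
From mathcomp Require Import all_classical all_reals all_analysis.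
From mathcomp Require Import ring lra.
Require Import Defs.
Set Implicit Arguments.
Unset Strict Implicit.
Unset Printing Implicit Defensive.
Import Order.TTheory GRing.Theory Num.Theory.
Import numFieldNormedType.Exports.
Local Open Scope classical_set_scope.
Local Open Scope ring_scope.

(** * Matrix calculus and Schwarz's theorem *)

Section MatrixCalculus.
Variables (R : realType) (V : normedModType R).

Lemma derive_coord m n (A : V -> 'M[R]_(m, n)) t v i j :
  derivable A t v -> 'D_v (fun x => A x i j) t = ('D_v A t) i j.
Proof. by move=> dA; rewrite derive_mx// mxE. Qed.

Lemma derivable_coord m n (A : V -> 'M[R]_(m, n)) t v i j :
  derivable A t v -> derivable (fun x => A x i j) t v.
Proof. by move=> /derivable_mxP. Qed.

Lemma derivable_trmx m n (A : V -> 'M[R]_(m, n)) t v :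
  derivable A t v -> derivable (fun x => (A x)^T) t v.
Proof.
move=> dA; apply/derivable_mxP => i j.
rewrite (_ : (fun x => _) = (fun x => A x j i)); first exact: derivable_coord.
by apply/funext => x; rewrite mxE.
Qed.

Lemma derive_trmx m n (A : V -> 'M[R]_(m, n)) t v :
  derivable A t v -> 'D_v (fun x => (A x)^T) t = ('D_v A t)^T.
Proof.
move=> dA; rewrite derive_mx; last exact: derivable_trmx.
apply/matrixP => i j; rewrite !mxE -derive_coord//; congr ('D_v _ t).
by apply/funext => x; rewrite mxE.
Qed.

Lemma is_derive_mulmx m n p (A : V -> 'M[R]_(m, n)) (B : V -> 'M[R]_(n, p)) t v
    i k :
  derivable A t v -> derivable B t v ->
  is_derive t v (fun x => (A x *m B x) i k)
    (('D_v A t *m B t + A t *m 'D_v B t) i k).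
Proof.
move=> dA dB.
rewrite (_ : (fun x => _) =
  \sum_j ((fun x => A x i j) * (fun x => B x j k))); last first.
  by apply/funext => x; rewrite mxE fct_sumE.
have H j : is_derive t v ((fun x => A x i j) * (fun x => B x j k))
    (A t i j *: ('D_v B t) j k + B t j k *: ('D_v A t) i j).
  apply: is_deriveM.
    by rewrite -derive_coord//; apply/derivableP/derivable_coord.
  by rewrite -derive_coord//; apply/derivableP/derivable_coord.
have -> : ('D_v A t *m B t + A t *m 'D_v B t) i k =
    \sum_j (A t i j *: ('D_v B t) j k + B t j k *: ('D_v A t) i j).
  rewrite !mxE -big_split/=; apply: eq_bigr => j _.
  by rewrite addrC [X in _ + X]mulrC.
exact: is_derive_sum.
Qed.

Lemma derivable_mulmx m n p (A : V -> 'M[R]_(m, n)) (B : V -> 'M[R]_(n, p)) t v :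
  derivable A t v -> derivable B t v ->
  derivable (fun x => A x *m B x) t v.
Proof.
by move=> dA dB; apply/derivable_mxP => i j; have [] := is_derive_mulmx i j dA dB.
Qed.

Lemma derive_mulmx m n p (A : V -> 'M[R]_(m, n)) (B : V -> 'M[R]_(n, p)) t v :
  derivable A t v -> derivable B t v ->
  'D_v (fun x => A x *m B x) t = 'D_v A t *m B t + A t *m 'D_v B t.
Proof.
move=> dA dB; rewrite derive_mx; last exact: derivable_mulmx.
by apply/matrixP => i j; have [_ <-] := is_derive_mulmx i j dA dB; rewrite mxE.
Qed.

Lemma derive_chain (W X : normedModType R) (f : V -> W) (g : W -> X) x v :
  differentiable f x -> differentiable g (f x) ->
  'D_v (g \o f) x = 'D_('D_v f x) g (f x).
Proof.
move=> df dg; rewrite deriveE; last exact: differentiable_comp.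
by rewrite diff_comp// !deriveE.
Qed.

Lemma derive_linear (W : normedModType R) (f : V -> W) x a v w :
  differentiable f x -> 'D_(a *: v + w) f x = a *: 'D_v f x + 'D_w f x.
Proof. by move=> df; rewrite !deriveE// linearP. Qed.

(** The one-variable mean value theorem, applied to the restriction of [f] to the segment from [x]
    to [x + s *: v]. *)
Lemma mean_value (f : V -> R) (x v : V) (s : R) : 0 < s ->
  (forall r, 0 <= r <= s -> derivable f (x + r *: v) v) ->
  exists2 r, 0 < r < s & f (x + s *: v) - f x = ('D_v f (x + r *: v) : R) * s.
Proof.
move=> s0 df; pose g h := f (x + h *: v).
have gE r : (fun h => h^-1 *: (g (h *: 1 + r) - g r)) =
            (fun h => h^-1 *: (f (h *: v + (x + r *: v)) - f (x + r *: v))).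
  apply/funext => h; rewrite /g; congr (_ *: (f _ - _)).
  by rewrite [h *: 1]mulr1 scalerDl addrCA.
have dg r : 0 <= r <= s -> is_derive r 1 g ('D_v f (x + r *: v)).
  move=> /df dfr; apply: DeriveDef; rewrite /derivable /derive.
    by have := dfr; rewrite /derivable -gE.
  by rewrite -gE.
have [||r] := @MVT R g (fun r => 'D_v f (x + r *: v)) 0 s s0.
- by move=> r; rewrite in_itv/= => /andP[/ltW r0 /ltW rs]; apply: dg; rewrite r0.
- apply: derivable_within_continuous => r; rewrite in_itv/= => rs.
  by have [] := dg _ rs.
- rewrite in_itv/= => rs; rewrite /g scale0r addr0 subr0 => E.
  by exists r.
Qed.

Lemma is_derive_translate (W : normedModType R) (f : V -> W) x a v :
  derivable f (x + a) v ->
  is_derive x v (fun y => f (y + a)) ('D_v f (x + a)).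
Proof.
have E : (fun h => h^-1 *: (f (h *: v + x + a) - f (x + a))) =
         (fun h => h^-1 *: (f (h *: v + (x + a)) - f (x + a))).
  by apply/funext => h; rewrite addrA.
by move=> df; apply: DeriveDef; rewrite /derivable /derive E.
Qed.

(** The second difference [D] of [f] over a small parallelogram at [u] is, by two applications of
    the mean value theorem, [s * s] times a value of either mixed derivative inside the
    parallelogram; continuity at [u] then identifies the two. *)
Lemma schwarz (f : V -> R) (u v w : V) :
  (\near u, derivable f u v /\ derivable f u w /\
     derivable ('D_v f) u w /\ derivable ('D_w f) u v) ->
  {for u, continuous ('D_w ('D_v f))} -> {for u, continuous ('D_v ('D_w f))} ->
  'D_w ('D_v f) u = 'D_v ('D_w f) u.
Proof.
move=> nf c1 c2; apply/eqP; rewrite -subr_eq0 -normr_eq0 eq_le normr_ge0 andbT.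
apply/ler_addgt0Pr => e e0; rewrite add0r.
have e2 : 0 < e / 2 by rewrite divr_gt0.
move/cvgrPdist_le : c1 => /(_ _ e2) n1.
move/cvgrPdist_le : c2 => /(_ _ e2) n2.
have [d /= d0 H] := (nbhs_ballP _ _).1 (filterI nf (filterI n1 n2)).
(* The parallelogram spanned by [s *: v] and [s *: w] stays in the ball; the added [1] keeps the
   denominator positive when both vectors vanish. *)
have [s s0 sd] : exists2 s : R, 0 < s & s * (`|v| + `|w|) < d.
  exists (d / (`|v| + `|w| + 1)).
    by rewrite divr_gt0// ltr_wpDl// addr_ge0.
  by rewrite mulrAC ltr_pdivrMr ?ltr_wpDl ?addr_ge0// ltr_pM2l// ltrDl.
have Hb (a b : R) : 0 <= a <= s -> 0 <= b <= s -> ball u d (u + a *: v + b *: w).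
  move=> /andP[a0 as_] /andP[b0 bs]; rewrite -ball_normE/= -addrA opprD addNKr.
  rewrite normrN (le_lt_trans _ sd)// (le_trans (ler_normD _ _))// !normrZ.
  by rewrite mulrDr !ger0_norm// lerD// ler_wpM2r.
have s0s : 0 <= (0 : R) <= s by rewrite lexx ltW.
have sss : 0 <= s <= s by rewrite lexx ltW.
have i01 (r : R) : 0 < r < s -> 0 <= r <= s by move=> /andP[? ?]; rewrite !ltW.
have Hb0 (a : R) : 0 <= a <= s -> ball u d (u + a *: v).
  by move=> /Hb/(_ s0s); rewrite scale0r addr0.
have Hb0' (a : R) : 0 <= a <= s -> ball u d (u + a *: w).
  by move=> /(Hb 0 _ s0s); rewrite scale0r addr0.
pose D := f (u + s *: v + s *: w) - f (u + s *: v) - f (u + s *: w) + f u.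
(* [D] is the increment along [v] of [g], itself the increment of [f] along [w]; the mean value
   theorem is applied to [g], then to ['D_v f]. *)
have [r1 r1s [t1 t1s E1]] : exists2 r, 0 < r < s & exists2 t, 0 < t < s &
    D = ('D_w ('D_v f) (u + r *: v + t *: w) : R) * (s * s).
  pose g := (fun x => f (x + s *: w)) - f.
  have dsh x : derivable f (x + s *: w) v ->
      is_derive x v (fun x => f (x + s *: w)) ('D_v f (x + s *: w)).
    exact: is_derive_translate.
  have dg r : 0 <= r <= s -> is_derive (u + r *: v) v g
     ('D_v f (u + r *: v + s *: w) - 'D_v f (u + r *: v)).
    move=> rs; apply: is_deriveB.
      by apply: dsh; have [[? _] _] := H _ (Hb _ _ rs sss).
    by apply/derivableP; have [[? _] _] := H _ (Hb0 _ rs).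
  have [||r rs E] := @mean_value g u v s.
  - by case/andP: sss.
  - by move=> r /dg [].
  exists r; [exact: rs|]; have [||t ts E'] := @mean_value ('D_v f) (u + r *: v) w s.
  - by [].
  - by move=> t ts; have [[_ [_ [? _]]] _] := H _ (Hb _ _ (i01 _ rs) ts).
  exists t; [exact: ts|]; have [_ dgE] := dg r (i01 _ rs).
  rewrite mulrA -E' -dgE -E /g /D -!/(_ - _) !fctE.
  by rewrite opprB addrA [LHS]addrAC.
have [r2 r2s [t2 t2s E2]] : exists2 r, 0 < r < s & exists2 t, 0 < t < s &
    D = ('D_v ('D_w f) (u + r *: v + t *: w) : R) * (s * s).
  pose g := (fun x => f (x + s *: v)) - f.
  have dg r : 0 <= r <= s -> is_derive (u + r *: w) w g
     ('D_w f (u + r *: w + s *: v) - 'D_w f (u + r *: w)).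
    move=> rs; apply: is_deriveB.
      apply: is_derive_translate; rewrite addrAC.
      by have [[_ [? _]] _] := H _ (Hb _ _ sss rs).
    by apply/derivableP; have [[_ [? _]] _] := H _ (Hb0' _ rs).
  have [||t ts E] := @mean_value g u w s.
  - by case/andP: sss.
  - by move=> r /dg [].
  have [||r rs E'] := @mean_value ('D_w f) (u + t *: w) v s.
  - by [].
  - move=> r rs; rewrite addrAC.
    by have [[_ [_ [_ ?]]] _] := H _ (Hb _ _ rs (i01 _ ts)).
  exists r; [exact: rs|exists t; [exact: ts|]]; have [_ dgE] := dg t (i01 _ ts).
  rewrite mulrA [u + r *: v + _]addrAC -E' -dgE -E /g /D !fctE.
  rewrite [u + s *: w + _]addrAC opprB addrA [RHS]addrAC.
  by rewrite [X in X + f u = _]addrAC.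
(* Dividing the two expressions of [D] by [s * s] equates the mixed derivatives at two points of the
   ball, where each is within [e / 2] of its value at [u]. *)
have EE : 'D_w ('D_v f) (u + r1 *: v + t1 *: w) =
          'D_v ('D_w f) (u + r2 *: v + t2 *: w).
  have ss : s * s != 0 by rewrite mulf_neq0 ?gt_eqF.
  apply: (mulIf ss); exact: etrans (esym E1) E2.
have [_ [/= b1 _]] := H _ (Hb _ _ (i01 _ r1s) (i01 _ t1s)).
have [_ [_ /= b2]] := H _ (Hb _ _ (i01 _ r2s) (i01 _ t2s)).
rewrite (splitr e) -(subrKA ('D_w ('D_v f) (u + r1 *: v + t1 *: w))).
apply: le_trans (ler_normD _ _) _; apply: lerD; first exact: b1.
rewrite EE distrC; exact: b2.
Qed.

End MatrixCalculus.

(** * Smooth functions *)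

Section SmoothFunctions.
Variables (R : realType) (V : normedModType R).
Implicit Types (U : set V).

(** The difference [g - f] vanishes near [x], hence is a little-o of the increment and has
    differential zero. *)
Lemma near_eq_differentiable (W : normedModType R) (f g : V -> W) x :
  (\near x, f x = g x) -> differentiable f x -> differentiable g x.
Proof.
move=> fg df; rewrite (_ : g = f + (g - f)); last by rewrite addrC subrK.
apply: differentiableD => //; set k := g - f.
have k0 : continuous (\0 : V -> W) /\
    k \o shift x = cst (k x) + \0 +o_ 0 id.
  split; first exact: cst_continuous.
  apply/eqaddoP => _/posnumP[e]; rewrite !near_simpl.
  have nk : \forall y \near x, k y = 0.
    by apply: filterS fg => y fgy; rewrite /k -[LHS]/(g y - f y) fgy subrr.
  have kx : k x = 0 by apply: nbhs_singleton nk.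
  have : \forall h \near (0 : V), k (h + x) = 0.
    by move: nk; rewrite (near_shift 0) subr0.
  apply: filterS => h kh.
  by rewrite !fctE/= kh kx addr0 subr0 normr0 mulr_ge0.
have dk : 'd k x = \0 :> (V -> W) by apply: diff_unique; case: k0.
by apply/diff_locallyP; rewrite dk.
Qed.

Lemma open_near U x (P : V -> Prop) :
  open U -> U x -> (forall y, U y -> P y) -> \forall y \near x, P y.
Proof.
by move=> oU Ux UP; apply: filterS UP _; apply: open_nbhs_nbhs.
Qed.

(** Derivatives depend only on germs. This allows a function to be given by a different formula near
    each point. *)
Lemma Ck_on_local (W : normedModType R) k (f : V -> W) U :
  (forall x, U x -> exists A (g : V -> W),
     [/\ open A, A x, Ck_on A k g & forall y, A y -> g y = f y]) ->
  Ck_on U k f.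
Proof.
elim: k f => [|k IH] f H /=.
  move=> x /H[A [g [oA Ax cg gf]]].
  have cgx : g @ x --> g x := cg _ Ax.
  rewrite /prop_for /continuous_at -(gf _ Ax); apply: cvg_trans cgx.
  by apply: near_eq_cvg; apply: open_near Ax _.
split=> [x /H[A [g [oA Ax [dg _] gf]]]|v].
  by apply: near_eq_differentiable (dg _ Ax); apply: open_near Ax _.
apply: IH => x /H[A [g [oA Ax [_ cg] gf]]].
exists A, ('D_v g); split=> // [|y Ay]; first exact: cg.
by apply: near_eq_derive; exact: open_near Ay _.
Qed.

Lemma Ck_on_ext (W : normedModType R) k (f g : V -> W) U :
  open U -> (forall x, U x -> g x = f x) -> Ck_on U k g -> Ck_on U k f.
Proof. by move=> oU gf cg; apply: Ck_on_local => x Ux; exists U, g. Qed.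

Lemma Ck_on_subset (W : normedModType R) k (f : V -> W) (U U' : set V) :
  U `<=` U' -> Ck_on U' k f -> Ck_on U k f.
Proof.
move=> UU'; elim: k f => [|k IH] f /=; first by move=> H x /UU'/H.
by move=> [df cf]; split=> [x /UU'/df //|v]; apply: IH.
Qed.

Lemma Ck_on_pred (W : normedModType R) k (f : V -> W) U :
  Ck_on U k.+1 f -> Ck_on U k f.
Proof.
elim: k f => [|k IH] f [df cf] /=.
  by move=> x /df; exact: differentiable_continuous.
by split=> // v; apply: IH.
Qed.

Lemma Ck_on_cst (W : normedModType R) k (a : W) U : Ck_on U k (cst a).
Proof.
elim: k a => [|k IH] a /=; first by move=> x _; exact: cst_continuous.
split=> [x _|v]; first exact: differentiable_cst.
rewrite (_ : 'D_v _ = cst 0); first exact: IH.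
by apply/funext => x; rewrite derive_cst.
Qed.

Lemma Ck_onD (W : normedModType R) k (f g : V -> W) U : open U ->
  Ck_on U k f -> Ck_on U k g -> Ck_on U k (fun x => f x + g x).
Proof.
move=> oU; elim: k f g => [|k IH] f g /=.
  by move=> cf cg x Ux; apply: cvgD; [exact: cf|exact: cg].
move=> [df cf] [dg cg]; split=> [x Ux|v].
  by apply: differentiableD; [exact: df|exact: dg].
apply: (Ck_on_ext (g := fun x => 'D_v f x + 'D_v g x)) => // [x Ux|].
  by rewrite -deriveD//; apply: diff_derivable; [exact: df|exact: dg].
exact: IH.
Qed.

Lemma Ck_onM k (f g : V -> R) U : open U ->
  Ck_on U k f -> Ck_on U k g -> Ck_on U k (fun x => f x * g x).
Proof.
move=> oU; elim: k f g => [|k IH] f g.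
  by move=> cf cg x Ux; apply: cvgM; [exact: cf|exact: cg].
move=> Cf Cg; have [df cf] := Cf; have [dg cg] := Cg; split=> [x Ux|v].
  by apply: differentiableM; [exact: df|exact: dg].
apply: (Ck_on_ext (g := fun x => f x * 'D_v g x + g x * 'D_v f x)) => // [x Ux|].
  by rewrite -deriveM//; apply: diff_derivable; [exact: df|exact: dg].
apply: Ck_onD => //; apply: IH.
- exact: Ck_on_pred Cf.
- exact: cg.
- exact: Ck_on_pred Cg.
- exact: cf.
Qed.

Lemma Ck_onN k (f : V -> R) U : open U ->
  Ck_on U k f -> Ck_on U k (fun x => - f x).
Proof.
move=> oU cf; apply: (Ck_on_ext (g := fun x => -1 * f x)) => // [x _|].
  by rewrite mulN1r.
by apply: Ck_onM => //; exact: (@Ck_on_cst R).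
Qed.

(** The derivative of [1 / f] is [- f' / f ^ 2], a product of factors that are already of class [k]
    by induction. *)
Lemma Ck_onV k (f : V -> R) U : open U ->
  (forall x, U x -> f x != 0) ->
  Ck_on U k f -> Ck_on U k (fun x => (f x)^-1).
Proof.
move=> oU f0; elim: k => [|k IH].
  by move=> cf x Ux; apply: cvgV; [exact: f0|exact: cf].
move=> Cf; have [df cf] := Cf; split=> [x Ux|v].
  by apply: differentiableV; [exact: df|exact: f0].
have Ci := IH (Ck_on_pred Cf).
apply: (Ck_on_ext (g := fun x => - ((f x)^-1 * (f x)^-1) * 'D_v f x)) => //.
  move=> x Ux; rewrite deriveV ?f0//; last by apply: diff_derivable; exact: df.
  by rewrite expr2 invfM.
apply: Ck_onM => //; last exact: cf.
by apply: Ck_onN => //; exact: Ck_onM.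
Qed.

Lemma Ck_on_sum k (I : Type) (r : seq I) (P : pred I) (f : I -> V -> R) U :
  open U -> (forall i, Ck_on U k (f i)) ->
  Ck_on U k (fun x => \sum_(i <- r | P i) f i x).
Proof.
move=> oU cf; elim: r => [|i r IH].
  apply: (Ck_on_ext (g := cst 0 : V -> R)) => // [x _|].
    by rewrite big_nil.
  exact: (@Ck_on_cst R).
have [Pi|Pi] := boolP (P i).
  apply: (Ck_on_ext (g := fun x => f i x + \sum_(i <- r | P i) f i x)) => //.
    by move=> x _; rewrite big_cons Pi.
  exact: Ck_onD.
apply: Ck_on_ext IH => // x _; by rewrite big_cons (negbTE Pi).
Qed.

Lemma Ck_on_prod k (I : Type) (r : seq I) (P : pred I) (f : I -> V -> R) U :
  open U -> (forall i, Ck_on U k (f i)) ->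
  Ck_on U k (fun x => \prod_(i <- r | P i) f i x).
Proof.
move=> oU cf; elim: r => [|i r IH].
  apply: (Ck_on_ext (g := cst 1 : V -> R)) => // [x _|].
    by rewrite big_nil.
  exact: (@Ck_on_cst R).
have [Pi|Pi] := boolP (P i).
  apply: (Ck_on_ext (g := fun x => f i x * \prod_(i <- r | P i) f i x)) => //.
    by move=> x _; rewrite big_cons Pi.
  exact: Ck_onM.
apply: Ck_on_ext IH => // x _; by rewrite big_cons (negbTE Pi).
Qed.

Lemma Ck_on_coord k m n (A : V -> 'M[R]_(m, n)) U i j : open U ->
  Ck_on U k A -> Ck_on U k (fun x => A x i j).
Proof.
move=> oU; elim: k A => [|k IH] A.
  move=> cA x Ux.
  apply: (@continuous_comp _ _ _ A (fun M : 'M[R]_(m, n) => M i j)).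
    exact: cA.
  exact: matrix_normedtype.coord_continuous.
move=> [dA cA]; split=> [x Ux|v].
  apply: (@differentiable_comp _ _ _ _ A (fun M : 'M[R]_(m, n) => M i j)).
    exact: dA.
  exact: differentiable_coord.
apply: (Ck_on_ext (g := fun x => ('D_v A x) i j)) => // [x Ux|]; last first.
  by apply: IH; exact: cA.
by rewrite derive_coord//; apply: diff_derivable; exact: dA.
Qed.

Lemma Ck_on_det k n (A : V -> 'M[R]_n) U : open U ->
  (forall i j, Ck_on U k (fun x => A x i j)) -> Ck_on U k (fun x => \det (A x)).
Proof.
move=> oU cA; apply: Ck_on_sum => // s; apply: Ck_onM => //.
  exact: (@Ck_on_cst R).
by apply: Ck_on_prod.
Qed.

(** Cramer's rule: the entries of the inverse are cofactors divided by the determinant. *)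
Lemma Ck_on_invmx k n (A : V -> 'M[R]_n) U i j : open U ->
  (forall x, U x -> A x \in unitmx) ->
  (forall i j, Ck_on U k (fun x => A x i j)) ->
  Ck_on U k (fun x => invmx (A x) i j).
Proof.
move=> oU uA cA.
apply: (Ck_on_ext
   (g := fun x => (\det (A x))^-1 * cofactor (A x) j i)) => // [x Ux|].
  by rewrite /invmx uA// !mxE.
apply: Ck_onM => //.
  apply: Ck_onV => // [x Ux|]; last exact: Ck_on_det.
  by have := uA _ Ux; rewrite unitmxE unitfE.
apply: Ck_onM => //; first exact: (@Ck_on_cst R).
apply: Ck_on_det => // a b.
apply: Ck_on_ext (cA (lift j a) (lift i b)) => // x _.
by rewrite !mxE.
Qed.

End SmoothFunctions.

Section SmoothMaps.
Variables (R : realType) (V : normedModType R).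
Implicit Types (U : set V).

Lemma schwarz_Ck (f : V -> R) U x v w : open U -> U x ->
  Ck_on U 2 f -> 'D_v ('D_w f) x = 'D_w ('D_v f) x.
Proof.
move=> oU Ux [df C1]; apply: schwarz.
- apply: (open_near oU Ux) => y Uy; have [dv _] := C1 v; have [dw _] := C1 w.
  split; [|split; [|split]]; apply: diff_derivable.
  - exact: df.
  - exact: df.
  - exact: dw.
  - exact: dv.
- by have [_ c] := C1 w; exact: c.
- by have [_ c] := C1 v; exact: c.
Qed.

Lemma schwarz_mx m n (A : V -> 'M[R]_(m, n)) U x v w : open U -> U x ->
  Ck_on U 2 A -> 'D_v ('D_w A) x = 'D_w ('D_v A) x.
Proof.
move=> oU Ux C2; have [dA C1] := C2; apply/matrixP => i j.
have step a b : ('D_a ('D_b A) x) i j = 'D_a ('D_b (fun y => A y i j)) x.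
  rewrite -derive_coord; last by apply: diff_derivable; have [+ _] := C1 b; exact.
  apply: near_eq_derive; apply: (open_near oU Ux) => y Uy.
  by rewrite derive_coord//; apply: diff_derivable; exact: dA.
apply: etrans (step v w) (etrans _ (esym (step w v))).
have Cij : Ck_on U 2 (fun y => A y i j).
  exact: Ck_on_coord oU C2.
exact: schwarz_Ck oU Ux Cij.
Qed.

Lemma derive_sum_delta n (W : normedModType R) (g : 'rV[R]_n -> W) y c :
  differentiable g y -> 'D_c g y = \sum_j c 0 j *: 'D_(delta_mx 0 j) g y.
Proof.
move=> dg; rewrite deriveE// {1}(row_sum_delta c) linear_sum.
by apply: eq_bigr => j _; rewrite linearZ deriveE.
Qed.

(** Written in coordinates, the chain rule gives a finite sum of products, and the induction
    hypothesis applies to the partial derivatives of [g] composed with [f]. *)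
Lemma Ck_on_comp k n (f : V -> 'rV[R]_n) (g : 'rV[R]_n -> R) U
    (W : set 'rV[R]_n) : open U -> (forall x, U x -> W (f x)) ->
  Ck_on U k f -> Ck_on W k g -> Ck_on U k (fun x => g (f x)).
Proof.
move=> oU UW; elim: k f g UW => [|k IH] f g UW.
  move=> cf cg x Ux; apply: (@continuous_comp _ _ _ f g); first exact: cf.
  by apply: cg; exact: UW.
move=> Cf Cg; have [df cf] := Cf; have [dg cg] := Cg; split=> [x Ux|v].
  by apply: (@differentiable_comp _ _ _ _ f g); [exact: df|apply: dg; exact: UW].
apply: (Ck_on_ext (g := fun x =>
   \sum_j ('D_v f x) 0 j * 'D_(delta_mx 0 j) g (f x))) => // [x Ux|].
  rewrite -[LHS]/(\sum_j ('D_v f x) 0 j *: 'D_(delta_mx 0 j) g (f x)).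
  have dgf := dg _ (UW _ Ux).
  by rewrite -derive_sum_delta// -derive_chain//; exact: df.
apply: Ck_on_sum => // j; apply: Ck_onM => //.
  by apply: Ck_on_coord => //; exact: cf.
apply: (IH f ('D_(delta_mx 0 j) g) UW); first exact: Ck_on_pred Cf.
exact: cg.
Qed.

End SmoothMaps.

(** * Levi-Civita connection *)

Section Inner.
Variables (R : realType) (n : nat).
Implicit Types (G : 'M[R]_n) (v w : 'rV[R]_n).

Lemma innerDl G v v' w : inner G (v + v') w = inner G v w + inner G v' w.
Proof. by rewrite /inner !mulmxDl mxE. Qed.

Lemma innerDr G v w w' : inner G v (w + w') = inner G v w + inner G v w'.
Proof. by rewrite /inner linearD mulmxDr mxE. Qed.

Lemma innerZl G a v w : inner G (a *: v) w = a * inner G v w.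
Proof. by rewrite /inner -!scalemxAl mxE. Qed.

Lemma innerZr G a v w : inner G v (a *: w) = a * inner G v w.
Proof. by rewrite /inner linearZ -!scalemxAr mxE. Qed.

Lemma innerBl G v v' w : inner G (v - v') w = inner G v w - inner G v' w.
Proof. by rewrite innerDl -scaleN1r innerZl mulN1r. Qed.

Lemma inner_sym G v w : G^T = G -> inner G v w = inner G w v.
Proof.
move=> sG; rewrite /inner -[in LHS]sG -[RHS]trace_mx11 -mxtrace_tr trace_mx11.
by rewrite !trmx_mul trmxK mulmxA.
Qed.

Lemma inner_mulmx m G (A : 'M[R]_(m, n)) (v w : 'rV[R]_m) :
  inner (A *m G *m A^T) v w = inner G (v *m A) (w *m A).
Proof. by rewrite /inner trmx_mul !mulmxA. Qed.

Lemma inner_inj G v w : G \in unitmx ->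
  (forall z, inner G v z = inner G w z) -> v = w.
Proof.
move=> uG H; apply: (can_inj (mulmxK uG)); apply/rowP => k.
have := H (delta_mx 0 k); rewrite /inner trmx_delta.
by rewrite -!colE !mxE.
Qed.

Lemma innerE G v w : inner G v w = \sum_i \sum_j v 0 i * G i j * w 0 j.
Proof.
rewrite /inner mxE exchange_big/=; apply: eq_bigr => j _.
by rewrite !mxE big_distrl.
Qed.

End Inner.

(** The Christoffel symbols as a bilinear map: the covariant derivative along [v] of the field with
    constant components [w]. *)
Definition gamma (R : realType) n (G : 'rV[R]_n -> 'M[R]_n) (u v w : 'rV[R]_n) :
    'rV[R]_n :=
  \sum_i \sum_j (v 0 i * w 0 j) *: christoffel G u i j.

(** A pseudo-Riemannian metric of arbitrary signature in coordinates. *)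
Definition metric_field (R : realType) n (W : set 'rV[R]_n)
    (G : 'rV[R]_n -> 'M[R]_n) : Prop :=
  [/\ open W, smooth_on W G, forall x, W x -> G x \in unitmx
    & forall x, W x -> (G x)^T = G x].

(** The derivative along [v] of the product of the fields with constant components [w] and [z]. *)
Definition derive_metric (R : realType) n (G : 'rV[R]_n -> 'M[R]_n)
    (u v w z : 'rV[R]_n) : R :=
  inner ('D_v G u) w z.

Section LeviCivita.
Variables (R : realType) (n : nat) (W : set 'rV[R]_n).
Variables (G : 'rV[R]_n -> 'M[R]_n) (mG : metric_field W G).

Lemma cov_cst u v w : cov G (cst w) v u = gamma G u v w.
Proof. by rewrite /cov /cov_along derive_cst add0r derive_id. Qed.

Lemma metric_differentiable u : W u -> differentiable G u.
Proof. by case: mG => _ sG _ _ Wu; have [dG _] := sG 1%N; exact: dG. Qed.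

Lemma derive_metric_sym u v : W u -> ('D_v G u)^T = 'D_v G u.
Proof.
move=> Wu; have [oW _ _ symG] := mG.
rewrite -derive_trmx; last exact/diff_derivable/metric_differentiable.
by apply: near_eq_derive; apply: (open_near oW Wu) => x /symG.
Qed.

Lemma derive_metricE u v w z : W u ->
  derive_metric G u v w z = \sum_i \sum_j \sum_l
    v 0 i * w 0 j * z 0 l * 'D_(delta_mx 0 i) G u j l.
Proof.
move=> Wu; have DvE j l : 'D_v G u j l =
    \sum_i v 0 i * 'D_(delta_mx 0 i) G u j l.
  rewrite (derive_sum_delta v (metric_differentiable Wu)) summxE.
  by apply: eq_bigr => i _; rewrite mxE.
rewrite /derive_metric innerE.
under eq_bigr do under eq_bigr do rewrite DvE mulr_sumr mulr_suml.
under eq_bigr do rewrite exchange_big/=.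
rewrite exchange_big/=; apply: eq_bigr => i _.
apply: eq_bigr => j _; apply: eq_bigr => l _.
by ring.
Qed.

(** Koszul's formula for fields with constant components, whose brackets vanish. *)
Lemma gamma_lower u v w z : W u ->
  inner (G u) (gamma G u v w) z = 2^-1 *
    (derive_metric G u v w z + derive_metric G u w v z - derive_metric G u z v w).
Proof.
move=> Wu; have [_ _ uG symG] := mG.
pose a i j : 'rV[R]_n := \row_l ('D_(delta_mx 0 i) G u j l
   + 'D_(delta_mx 0 j) G u i l - 'D_(delta_mx 0 l) G u i j).
(* Lowering the index cancels the inverse Gram matrix in the Christoffel symbols. *)
have cE i j : christoffel G u i j *m G u = 2^-1 *: a i j.
  rewrite (_ : christoffel G u i j = 2^-1 *: (a i j *m invmx (G u))).
    by rewrite -scalemxAl mulmxKV// uG.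
  apply/rowP => k; rewrite !mxE; congr (_ * _); apply: eq_bigr => l _.
  have dG b : derivable G u b by exact/diff_derivable/metric_differentiable.
  rewrite !derive_coord// mxE mulrC; congr (_ * _).
  by rewrite -[in RHS](symG _ Wu) -trmx_inv mxE.
rewrite !(derive_metricE _ _ _ Wu) /inner /gamma !mulmx_suml summxE.
transitivity (\sum_i \sum_j \sum_l 2^-1 * (v 0 i * w 0 j * z 0 l *
  ('D_(delta_mx 0 i) G u j l
   + 'D_(delta_mx 0 j) G u i l - 'D_(delta_mx 0 l) G u i j))).
  apply: eq_bigr => i _; rewrite !mulmx_suml summxE; apply: eq_bigr => j _.
  rewrite -!scalemxAl cE -scalemxAl !mxE mulr_sumr mulr_sumr.
  by apply: eq_bigr => l _; rewrite !mxE; ring.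
(* The exchanges make the three trilinear expansions run over the same indices, so that they can be
   compared term by term. *)
rewrite [X in _ = _ * (_ + X - _)]exchange_big/=.
rewrite [X in _ = _ * (_ - X)]exchange_big/=.
under [X in _ = _ * (_ - X)]eq_bigr do rewrite exchange_big/=.
rewrite -big_split -sumrB mulr_sumr; apply: eq_bigr => i _.
rewrite -big_split -sumrB mulr_sumr; apply: eq_bigr => j _.
rewrite -big_split -sumrB mulr_sumr; apply: eq_bigr => l _.
by rewrite /=; ring.
Qed.

Lemma derive_metric_inner_sym u a w z : W u ->
  derive_metric G u a w z = derive_metric G u a z w.
Proof. by move=> Wu; apply: inner_sym; exact: derive_metric_sym. Qed.

Lemma gamma_torsion_free u v w : W u -> gamma G u v w = gamma G u w v.
Proof.
move=> Wu; have [_ _ uG _] := mG; apply: (inner_inj (uG _ Wu)) => z.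
rewrite !(gamma_lower _ _ _ Wu) (derive_metric_inner_sym z w v Wu).
generalize (derive_metric G u v w z) (derive_metric G u w v z) => x y.
by rewrite (addrC x).
Qed.

(** In the sum of Koszul's formulas for [(a, w, z)] and [(a, z, w)] the terms differentiating along
    [w] and [z] cancel. *)
Lemma gamma_metric u a w z : W u ->
  derive_metric G u a w z =
  inner (G u) (gamma G u a w) z + inner (G u) w (gamma G u a z).
Proof.
move=> Wu; have [_ _ _ symG] := mG.
rewrite (inner_sym w _ (symG _ Wu)) !(gamma_lower _ _ _ Wu).
rewrite (derive_metric_inner_sym a z w Wu).
generalize (derive_metric G u a w z) (derive_metric G u w a z)
  (derive_metric G u z a w) => x y t.
by field.
Qed.

Section Along.
Variables (m : nat) (F : 'rV[R]_m -> 'rV[R]_n) (u : 'rV[R]_m).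
Hypotheses (WF : W (F u)) (dF : differentiable F u).
Implicit Types (Y Z : 'rV[R]_m -> 'rV[R]_n).

(** Metric compatibility for fields along a map: the Leibniz rule, where [gamma_metric] in the
    direction ['D_v F u] accounts for the variation of the Gram matrix. *)
Lemma derive_inner_along Y Z v : derivable Y u v -> derivable Z u v ->
  'D_v (fun x => inner (G (F x)) (Y x) (Z x)) u =
  inner (G (F u)) (cov_along G F Y v u) (Z u) +
  inner (G (F u)) (Y u) (cov_along G F Z v u).
Proof.
move=> dY dZ; have dG := metric_differentiable WF.
have dGF : derivable (G \o F) u v.
  by apply: diff_derivable; apply: differentiable_comp.
have dYG : derivable (fun x => Y x *m (G \o F) x) u v.
  exact: derivable_mulmx.
have dZt := derivable_trmx dZ.
rewrite [LHS](derive_coord 0 0 (derivable_mulmx dYG dZt)).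
rewrite (derive_mulmx dYG dZt) (derive_mulmx dY dGF) (derive_trmx dZ).
rewrite (derive_chain _ dF dG) /=.
have := gamma_metric ('D_v F u) (Y u) (Z u) WF.
rewrite /cov_along -!/(gamma _ _ _ _) innerDl innerDr /derive_metric /inner.
by rewrite !mulmxDl !mxE; lra.
Qed.

End Along.

End LeviCivita.

(** * Second fundamental form in coordinates *)

Lemma smooth_differentiable (R : realType) (V X : normedModType R) (U : set V)
  (F : V -> X) x : smooth_on U F -> U x -> differentiable F x.
Proof. by move=> sF; have [dF _] := sF 1%N; exact: dF. Qed.

Lemma smooth_derive (R : realType) (V X : normedModType R) (U : set V)
  (F : V -> X) v : smooth_on U F -> smooth_on U ('D_v F).
Proof. by move=> sF k; have [_ cF] := sF k.+1; exact: cF. Qed.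

Lemma smooth_derivable (R : realType) (V X : normedModType R) (U : set V)
  (F : V -> X) x v : smooth_on U F -> U x -> derivable F x v.
Proof.
by move=> sF Ux; apply: diff_derivable; exact: smooth_differentiable sF Ux.
Qed.

Section GammaBilinear.
Variables (R : realType) (n : nat) (G : 'rV[R]_n -> 'M[R]_n) (u : 'rV[R]_n).

Lemma gamma_linearl a v v' w :
  gamma G u (a *: v + v') w = a *: gamma G u v w + gamma G u v' w.
Proof.
rewrite /gamma scaler_sumr -big_split; apply: eq_bigr => i _ /=.
rewrite scaler_sumr -big_split; apply: eq_bigr => j _ /=.
by rewrite !mxE scalerA -scalerDl; congr (_ *: _); ring.
Qed.

End GammaBilinear.

(** * Second derivatives and the second-order chain rule *)

Section SecondDerivative.
Variables (R : realType) (m n : nat) (U : set 'rV[R]_m).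
Variables (F : 'rV[R]_m -> 'rV[R]_n).
Hypotheses (oU : open U) (sF : smooth_on U F).

Lemma derive2_linearl u a v v' w : U u ->
  'D_(a *: v + v') ('D_w F) u = a *: 'D_v ('D_w F) u + 'D_v' ('D_w F) u.
Proof.
move=> Uu; apply: derive_linear; apply: smooth_differentiable Uu.
exact: smooth_derive.
Qed.

Lemma derive2_linearr u a v w w' : U u ->
  'D_v ('D_(a *: w + w') F) u = a *: 'D_v ('D_w F) u + 'D_v ('D_w' F) u.
Proof.
move=> Uu.
have d b : derivable ('D_b F) u v.
  by apply: smooth_derivable Uu; exact: smooth_derive.
transitivity ('D_v (a *: 'D_w F + 'D_w' F) u).
  apply: near_eq_derive; apply: (open_near oU Uu) => x Ux.
  by apply: derive_linear; exact: smooth_differentiable sF Ux.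
rewrite deriveD; [|exact: derivableZ|exact: d].
by rewrite deriveZ; [|exact: d].
Qed.

Lemma derive2_sum u v w : U u ->
  'D_v ('D_w F) u = \sum_j w 0 j *: 'D_v ('D_(delta_mx 0 j) F) u.
Proof.
move=> Uu; pose L b := 'D_v ('D_b F) u.
have L0 : L 0 = 0.
  have := derive2_linearr 1 v 0 0 Uu; rewrite !scale1r addr0 -/(L 0) => E.
  by apply: (addrI (L 0)); rewrite addr0 -E.
rewrite {1}(row_sum_delta w) -/(L _).
elim/big_rec2: _ => [//|j y1 y2 _ IH].
by rewrite -IH; exact: derive2_linearr.
Qed.

End SecondDerivative.

Section Composition.
Variables (R : realType) (m n p : nat) (U : set 'rV[R]_m) (U' : set 'rV[R]_n).
Variables (F : 'rV[R]_m -> 'rV[R]_n) (F' : 'rV[R]_n -> 'rV[R]_p).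
Hypotheses (oU : open U) (sF : smooth_on U F).
Hypotheses (oU' : open U') (sF' : smooth_on U' F').
Hypothesis (UU' : forall x, U x -> U' (F x)).

Lemma derive_comp x w : U x -> 'D_w (F' \o F) x = 'D_('D_w F x) F' (F x).
Proof.
move=> Ux; apply: derive_chain; first exact: smooth_differentiable sF Ux.
exact: smooth_differentiable sF' (UU' Ux).
Qed.

(** Differentiating the first-order chain rule once more yields the Hessian of [F'] on the image
    vectors and the differential of [F'] on the Hessian of [F]. *)
Lemma derive2_comp u v w : U u ->
  'D_v ('D_w (F' \o F)) u =
  'D_('D_v F u) ('D_('D_w F u) F') (F u)
  + 'D_v ('D_w F) u *m jacobian F' (F u).
Proof.
move=> Uu; have U'u := UU' Uu.
(* [B] is the Jacobian matrix of [F'] along [F], written with partial derivatives so that the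
   product rule for matrices applies to ['D_w F x *m B x]. *)
pose B x : 'M[R]_(n, p) := \matrix_(j, k) ('D_(delta_mx 0 j) F' (F x)) 0 k.
have dj j : differentiable ('D_(delta_mx 0 j) F') (F u).
  by apply: smooth_differentiable U'u; exact: smooth_derive.
have dF := smooth_differentiable sF Uu.
have dBj j : derivable (fun x => 'D_(delta_mx 0 j) F' (F x)) u v.
  apply: diff_derivable.
  exact: (@differentiable_comp _ _ _ _ F ('D_(delta_mx 0 j) F')).
have BE j k : (fun x => B x j k) = (fun x => ('D_(delta_mx 0 j) F' (F x)) 0 k).
  by apply/funext => x; rewrite mxE.
have dB : derivable B u v.
  apply/derivable_mxP => j k; rewrite BE; exact: derivable_coord.
have dA : derivable ('D_w F) u v.
  by apply: smooth_derivable Uu; exact: smooth_derive.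
transitivity ('D_v (fun x => 'D_w F x *m B x) u).
  apply: near_eq_derive; apply: (open_near oU Uu) => x Ux.
  rewrite derive_comp// derive_sum_delta; last first.
    exact: smooth_differentiable sF' (UU' Ux).
  rewrite mulmx_sum_row; apply: eq_bigr => j _; congr (_ *: _).
  by apply/rowP => k; rewrite !mxE.
rewrite derive_mulmx// [LHS]addrC; congr (_ + _); last congr (_ *m _).
  rewrite (derive2_sum oU' sF' _ _ U'u) mulmx_sum_row.
  apply: eq_bigr => j _; congr (_ *: _); apply/rowP => k.
  rewrite mxE -(derive_coord _ _ dB) BE (derive_coord _ _ (dBj j)).
  by rewrite (derive_chain v dF (dj j)).
apply/matrixP => j k; rewrite mxE.
rewrite (deriveEjacobian _ (smooth_differentiable sF' U'u)).
by rewrite -rowE mxE.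
Qed.

End Composition.

(** * Isometric immersions: symmetry and normality of the second fundamental form *)

Section Immersion.
Variables (R : realType) (m n : nat) (U : set 'rV[R]_m) (W : set 'rV[R]_n).
Variables (F : 'rV[R]_m -> 'rV[R]_n).
Variables (G1 : 'rV[R]_m -> 'M[R]_m) (G2 : 'rV[R]_n -> 'M[R]_n).
Hypotheses (oU : open U) (sF : smooth_on U F) (UW : forall x, U x -> W (F x)).
Hypotheses (mG1 : metric_field U G1) (mG2 : metric_field W G2).
Hypothesis isoF : forall x, U x ->
  G1 x = jacobian F x *m G2 (F x) *m (jacobian F x)^T.

Lemma cov_alongE Y v u : cov_along G2 F Y v u =
  'D_v Y u + gamma G2 (F u) ('D_v F u) (Y u).
Proof. by []. Qed.

(* [second_fundamental_form gM g f c d] is convertible to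
   [sff (rep f c d) (gM c) (g d)]. *)
Definition sff u v w : 'rV[R]_n :=
  cov_along G2 F ('D_w F) v u - cov G1 (cst w) v u *m jacobian F u.

Lemma sffE u v w : sff u v w =
  'D_v ('D_w F) u + gamma G2 (F u) ('D_v F u) ('D_w F u)
  - gamma G1 u v w *m jacobian F u.
Proof. by rewrite /sff cov_cst. Qed.

Lemma derive_jacobian x v : U x -> 'D_v F x = v *m jacobian F x.
Proof.
by move=> Ux; rewrite deriveEjacobian//; exact: smooth_differentiable sF Ux.
Qed.

Lemma inner_jacobian x v w : U x ->
  inner (G2 (F x)) ('D_v F x) ('D_w F x) = inner (G1 x) v w.
Proof. by move=> Ux; rewrite !derive_jacobian// isoF// inner_mulmx. Qed.

(** Schwarz's theorem handles the second derivatives of [F], and the absence of torsion the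
    Christoffel terms. *)
Lemma cov_along_sym u v w : U u ->
  cov_along G2 F ('D_w F) v u = cov_along G2 F ('D_v F) w u.
Proof.
move=> Uu; rewrite !cov_alongE (schwarz_mx v w oU Uu (sF 2)).
by rewrite (gamma_torsion_free mG2 ('D_v F u) ('D_w F u) (UW Uu)).
Qed.

Lemma sff_sym u v w : U u -> sff u v w = sff u w v.
Proof.
move=> Uu; rewrite /sff cov_along_sym// !cov_cst.
by rewrite (gamma_torsion_free mG1 _ _ Uu).
Qed.

(** Obtained by differentiating along [v] the identity [inner_jacobian], which holds on all of
    [U]. *)
Lemma derive_metric_pullback u v w z : U u ->
  derive_metric G1 u v w z =
  inner (G2 (F u)) (cov_along G2 F ('D_w F) v u) ('D_z F u) +
  inner (G2 (F u)) (cov_along G2 F ('D_z F) v u) ('D_w F u).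
Proof.
move=> Uu; have WFu := UW Uu; have [_ _ _ symG] := mG2.
have d b : derivable ('D_b F) u v.
  by apply: smooth_derivable Uu; exact: smooth_derive.
rewrite [X in _ = _ + X]inner_sym; last exact: symG.
rewrite -(derive_inner_along mG2 WFu (smooth_differentiable sF Uu) (d w) (d z)).
have dG1 : derivable G1 u v.
  by apply/diff_derivable/(metric_differentiable mG1).
transitivity ('D_v (fun x => inner (G1 x) w z) u); last first.
  apply: near_eq_derive; apply: (open_near oU Uu) => x Ux.
  by rewrite inner_jacobian.
have dw : derivable (fun x => cst w x *m G1 x) u v.
  by apply: derivable_mulmx => //; exact: derivable_cst.
have dz : derivable (cst z^T : 'rV[R]_m -> _) u v by exact: derivable_cst.
rewrite [RHS](derive_coord 0 0 (derivable_mulmx dw dz)) (derive_mulmx dw dz).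
rewrite (derive_mulmx (derivable_cst w u v) dG1) !derive_cst.
by rewrite mul0mx add0r mulmx0 addr0.
Qed.

(* By Koszul's formula, as [G1] is the pullback of [G2]. *)
Lemma gauss_formula u v w z : U u ->
  inner (G2 (F u)) (sff u v w) (z *m jacobian F u) = 0.
Proof.
move=> Uu; rewrite /sff innerBl cov_cst.
rewrite -(inner_mulmx (G2 (F u)) (jacobian F u)) -isoF//.
rewrite (gamma_lower mG1 _ _ _ Uu) -derive_jacobian//.
pose N a b := cov_along G2 F ('D_b F) a u.
have NE a b c : derive_metric G1 u a b c =
    inner (G2 (F u)) (N a b) ('D_c F u) + inner (G2 (F u)) (N a c) ('D_b F u).
  exact: derive_metric_pullback.
have Nsym a b : N a b = N b a by exact: cov_along_sym.
rewrite -/(N v w) !NE; clearbody N.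
rewrite (Nsym w v) (Nsym z v) (Nsym z w).
(* By the symmetry of [N], the six products in Koszul's formula reduce to three, and only the one
   with [N v w] survives, twice. *)
generalize (inner (G2 (F u)) (N v w) ('D_z F u))
  (inner (G2 (F u)) (N v z) ('D_w F u))
  (inner (G2 (F u)) (N w z) ('D_v F u)) => a b c.
by field.
Qed.

End Immersion.

(** * The cubic form of a Lagrangian immersion *)

Section Lagrangian.
Variables (R : realType) (m n : nat) (U : set 'rV[R]_m) (W : set 'rV[R]_n).
Variables (F : 'rV[R]_m -> 'rV[R]_n).
Variables (G1 : 'rV[R]_m -> 'M[R]_m) (G2 : 'rV[R]_n -> 'M[R]_n).
Hypotheses (oU : open U) (sF : smooth_on U F) (UW : forall x, U x -> W (F x)).
Hypothesis mG2 : metric_field W G2.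
Variable J : 'rV[R]_n -> 'M[R]_n.
Hypothesis sJ : smooth_on W J.
Hypothesis J_square : forall y, W y -> J y *m J y = - 1%:M.
Hypothesis J_isometry : forall y, W y -> forall v w,
  inner (G2 y) (v *m J y) (w *m J y) = inner (G2 y) v w.
Hypothesis J_parallel : forall y, W y -> forall v w : 'rV[R]_n,
  cov G2 (fun x => w *m J x) v y = cov G2 (cst w) v y *m J y.
Hypothesis lagF : forall x, U x -> forall w z,
  inner (G2 (F x)) (w *m jacobian F x) (z *m jacobian F x *m J (F x)) = 0.

Lemma cov_along_cplx (Y : 'rV[R]_m -> 'rV[R]_n) v u :
  U u -> derivable Y u v ->
  cov_along G2 F (fun x => Y x *m J (F x)) v u =
  cov_along G2 F Y v u *m J (F u).
Proof.
move=> Uu dY; have WFu := UW Uu.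
have dF := smooth_differentiable sF Uu.
have dJ := smooth_differentiable sJ WFu.
have dJF : derivable (J \o F) u v.
  by apply: diff_derivable; exact: differentiable_comp.
have := J_parallel WFu ('D_v F u) (Y u).
rewrite cov_cst /cov (cov_alongE idfun) derive_id.
rewrite (derive_mulmx (derivable_cst (Y u) (F u) ('D_v F u))); last first.
  exact: diff_derivable.
rewrite derive_cst mul0mx add0r => E.
rewrite !cov_alongE mulmxDl -E.
rewrite (derive_mulmx dY dJF) (derive_chain v dF dJ) /=.
by rewrite addrA.
Qed.

Lemma inner_cplx_skew y v w : W y ->
  inner (G2 y) v (w *m J y) = - inner (G2 y) w (v *m J y).
Proof.
move=> Wy; have [_ _ _ symG] := mG2.
rewrite -(J_isometry Wy v) -mulmxA J_square// mulmxN mulmx1.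
by rewrite -scaleN1r innerZr mulN1r inner_sym// symG.
Qed.

Definition cubic u v w z : R :=
  inner (G2 (F u)) (sff F G1 G2 u v w) (z *m jacobian F u *m J (F u)).

(** The tangential part subtracted in [sff] is orthogonal to the image of the tangent space under
    [J]. *)
Lemma cubicE u v w z : U u -> cubic u v w z =
  inner (G2 (F u)) (cov_along G2 F ('D_w F) v u) ('D_z F u *m J (F u)).
Proof.
move=> Uu; rewrite /cubic /sff innerBl (lagF Uu) subr0.
by rewrite (derive_jacobian sF _ Uu).
Qed.

Lemma cubic_sym23 u v w z : U u -> cubic u v w z = cubic u v z w.
Proof.
move=> Uu; have WFu := UW Uu; rewrite !(cubicE _ _ _ Uu).
have d b : derivable ('D_b F) u v.
  by apply: smooth_derivable Uu; exact: smooth_derive.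
have dF := smooth_differentiable sF Uu.
have dJF : derivable (fun x => J (F x)) u v.
  apply: diff_derivable; apply: (@differentiable_comp _ _ _ _ F J) => //.
  exact: smooth_differentiable sJ WFu.
have [_ _ _ symG] := mG2.
(* The Lagrangian condition makes this function vanish on the whole neighbourhood [U]; its
   derivative is the difference of the two sides, [J] being parallel and skew. *)
have : 'D_v (fun x => inner (G2 (F x)) ('D_w F x) ('D_z F x *m J (F x))) u = 0.
  rewrite -(derive_cst (0 : R) u v); apply: near_eq_derive.
  apply: (open_near oU Uu) => x Ux.
  by rewrite !(derive_jacobian sF _ Ux) lagF.
rewrite (derive_inner_along mG2 WFu dF (d w) (derivable_mulmx (d z) dJF)).
rewrite (cov_along_cplx Uu (d z)) [X in _ + X](inner_cplx_skew _ _ WFu).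
by move/eqP; rewrite subr_eq0 => /eqP.
Qed.

End Lagrangian.

(** * Linearity of the second fundamental form and its behaviour under composition *)

Lemma scaleBDDr (R : pzRingType) (V : lmodType R) a (x y z x' y' z' : V) :
  a *: x + x' + (a *: y + y') - (a *: z + z') =
  a *: (x + y - z) + (x' + y' - z').
Proof.
by rewrite scalerBr scalerDr opprD (addrACA (a *: x)) (addrACA _ _ (- _)).
Qed.

Lemma addrACKA (V : zmodType) (a b c d e : V) :
  a + b + c - d = a + c - e + (b + e - d).
Proof. by rewrite [RHS]addrA [b + e]addrC addrA subrK [a + c + b]addrAC. Qed.

Section SffBilinear.
Variables (R : realType) (m n : nat) (U : set 'rV[R]_m).
Variables (F : 'rV[R]_m -> 'rV[R]_n).
Variables (G1 : 'rV[R]_m -> 'M[R]_m) (G2 : 'rV[R]_n -> 'M[R]_n).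
Hypothesis sF : smooth_on U F.

Lemma sff_linearl u a v v' w : U u -> sff F G1 G2 u (a *: v + v') w =
  a *: sff F G1 G2 u v w + sff F G1 G2 u v' w.
Proof.
move=> Uu; rewrite !sffE (derive2_linearl sF _ _ _ _ Uu) derive_linear; last first.
  exact: smooth_differentiable sF Uu.
rewrite !gamma_linearl mulmxDl -scalemxAl.
exact: scaleBDDr.
Qed.

End SffBilinear.

Section SffComposition.
Variables (R : realType) (m n p : nat) (U : set 'rV[R]_m) (U' : set 'rV[R]_n).
Variables (F : 'rV[R]_m -> 'rV[R]_n) (F' : 'rV[R]_n -> 'rV[R]_p).
Hypotheses (oU : open U) (sF : smooth_on U F).
Hypotheses (oU' : open U') (sF' : smooth_on U' F').
Hypothesis (UU' : forall x, U x -> U' (F x)).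
Variables (G1 : 'rV[R]_m -> 'M[R]_m) (G2 : 'rV[R]_n -> 'M[R]_n).
Variable G3 : 'rV[R]_p -> 'M[R]_p.

(** The second-order chain rule, in which the Christoffel term of the intermediate space [G2] occurs
    in both summands with opposite signs and cancels. *)
Lemma sff_comp u v w : U u ->
  sff (F' \o F) G1 G3 u v w =
  sff F' G2 G3 (F u) ('D_v F u) ('D_w F u)
  + sff F G1 G2 u v w *m jacobian F' (F u).
Proof.
move=> Uu; rewrite !sffE (derive2_comp oU sF oU' sF' UU' _ _ Uu).
rewrite !(derive_comp sF sF' UU' _ Uu).
have -> : jacobian (F' \o F) u = jacobian F u *m jacobian F' (F u).
  apply/row_matrixP => i; rewrite !rowE -deriveEjacobian; last first.
    apply: differentiable_comp; first exact: smooth_differentiable sF Uu.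
    exact: smooth_differentiable sF' (UU' Uu).
  rewrite (derive_comp sF sF' UU' _ Uu) !deriveEjacobian ?mulmxA//.
  - exact: smooth_differentiable sF Uu.
  - exact: smooth_differentiable sF' (UU' Uu).
rewrite mulmxBl mulmxDl mulmxA /=.
exact: addrACKA.
Qed.

End SffComposition.

Lemma isometry_unitmx (R : realType) n (D G1 G2 : 'M[R]_n) :
  G1 \in unitmx -> G1 = D *m G2 *m D^T -> D \in unitmx.
Proof. by move=> + E; rewrite E !unitmx_mul => /andP[/andP[]]. Qed.

(** In equal dimensions the tangent space is the whole space, and a vector orthogonal to everything
    is zero. *)
Lemma sff_local_isometry (R : realType) n (U W : set 'rV[R]_n)
    (F : 'rV[R]_n -> 'rV[R]_n) (G1 G2 : 'rV[R]_n -> 'M[R]_n) u v w :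
  open U -> smooth_on U F -> (forall x, U x -> W (F x)) ->
  metric_field U G1 -> metric_field W G2 ->
  (forall x, U x -> G1 x = jacobian F x *m G2 (F x) *m (jacobian F x)^T) ->
  U u -> sff F G1 G2 u v w = 0.
Proof.
move=> oU sF UW mG1 mG2 isoF Uu; have WFu := UW _ Uu.
have [_ _ uG1 _] := mG1; have [_ _ uG2 _] := mG2.
have uJ := isometry_unitmx (uG1 _ Uu) (isoF _ Uu).
apply: (inner_inj (uG2 _ WFu)) => z.
rewrite -(mulmxKV uJ z) (gauss_formula oU sF UW mG1 mG2 isoF _ _ _ Uu).
by rewrite /inner !mul0mx mxE.
Qed.

(** * Smoothness of the second fundamental form *)

Section SmoothEntries.
Variables (R : realType) (V : normedModType R) (U : set V).
Hypothesis oU : open U.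

(** Smoothness is stated entry by entry to reduce matrix expressions to the closure properties of
    scalar functions. *)
Definition smooth_mx m n (A : V -> 'M[R]_(m, n)) : Prop :=
  forall i j, smooth_on U (fun x => A x i j).

Lemma smooth_on_mx m n (A : V -> 'M[R]_(m, n)) : smooth_on U A -> smooth_mx A.
Proof. by move=> sA i j k; exact: Ck_on_coord. Qed.

Lemma smooth_mx_ext m n (A B : V -> 'M[R]_(m, n)) :
  (forall x, U x -> B x = A x) -> smooth_mx B -> smooth_mx A.
Proof.
by move=> BA sB i j k; apply: (Ck_on_ext oU _ (sB i j k)) => x Ux; rewrite BA.
Qed.

Lemma smooth_mx_cst m n (M : 'M[R]_(m, n)) : smooth_mx (cst M).
Proof. by move=> i j k; exact: (@Ck_on_cst R). Qed.

Lemma smooth_mxD m n (A B : V -> 'M[R]_(m, n)) :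
  smooth_mx A -> smooth_mx B -> smooth_mx (fun x => A x + B x).
Proof.
move=> sA sB i j k; apply: Ck_on_ext (Ck_onD oU (sA i j k) (sB i j k)) => // x _.
by rewrite mxE.
Qed.

Lemma smooth_mxN m n (A : V -> 'M[R]_(m, n)) :
  smooth_mx A -> smooth_mx (fun x => - A x).
Proof.
move=> sA i j k; apply: Ck_on_ext (Ck_onN oU (sA i j k)) => // x _.
by rewrite mxE.
Qed.

Lemma smooth_mx_mul m n p (A : V -> 'M[R]_(m, n)) (B : V -> 'M[R]_(n, p)) :
  smooth_mx A -> smooth_mx B -> smooth_mx (fun x => A x *m B x).
Proof.
move=> sA sB i j k.
apply: (Ck_on_ext (g := fun x => \sum_l A x i l * B x l j)) => // [x _|].
  by rewrite mxE.
by apply: Ck_on_sum => // l; apply: Ck_onM => //; [exact: sA|exact: sB].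
Qed.

Lemma smooth_mx_tr m n (A : V -> 'M[R]_(m, n)) :
  smooth_mx A -> smooth_mx (fun x => (A x)^T).
Proof.
by move=> sA i j k; apply: Ck_on_ext (sA j i k) => // x _; rewrite mxE.
Qed.

Lemma smooth_inner n (G : V -> 'M[R]_n) (A B : V -> 'rV[R]_n) :
  smooth_mx G -> smooth_mx A -> smooth_mx B ->
  smooth_on U (fun x => inner (G x) (A x) (B x)).
Proof.
move=> sG sA sB.
have : smooth_mx (fun x => A x *m G x *m (B x)^T).
  by apply: smooth_mx_mul; [exact: smooth_mx_mul|exact: smooth_mx_tr].
exact.
Qed.

End SmoothEntries.

Lemma smooth_mx_comp (R : realType) (V : normedModType R) (U : set V) n
    (W : set 'rV[R]_n) p q (F : V -> 'rV[R]_n) (A : 'rV[R]_n -> 'M[R]_(p, q)) :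
  open U -> (forall x, U x -> W (F x)) -> smooth_on U F -> smooth_mx W A ->
  smooth_mx U (fun x => A (F x)).
Proof.
by move=> oU UW sF sA i j k; apply: Ck_on_comp oU UW (sF k) (sA i j k).
Qed.

Lemma smooth_christoffel (R : realType) n (W : set 'rV[R]_n)
    (G : 'rV[R]_n -> 'M[R]_n) i j :
  metric_field W G -> smooth_mx W (fun y => christoffel G y i j).
Proof.
move=> [oW sG uG _] a l k.
pose d (b : 'I_n) s t y : R := ('D_(delta_mx 0 b) G y) s t.
(* One order of differentiability is lost, so the smoothness of [G] is used at order [k.+1]. *)
have sd b s t : Ck_on W k (d b s t).
  by apply: (Ck_on_coord _ _ oW); have [_ cG] := sG k.+1; exact: cG.
apply: (Ck_on_ext (g := fun y => 2^-1 * \sum_b invmx (G y) l b *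
    (d i j b y + d j i b y + - d b i j y))) => // [y Wy|].
  rewrite mxE; congr (_ * _); apply: eq_bigr => b _.
  have dG c : derivable G y c by exact: smooth_derivable sG Wy.
  by rewrite !(derive_coord _ _ (dG _)).
apply: Ck_onM => //; first exact: (@Ck_on_cst R).
apply: Ck_on_sum => // b; apply: Ck_onM => //.
  by apply: Ck_on_invmx => // s t; exact: Ck_on_coord.
apply: Ck_onD => //; first exact: Ck_onD.
exact: Ck_onN.
Qed.

Section SmoothSff.
Variables (R : realType) (m n : nat) (U : set 'rV[R]_m) (W : set 'rV[R]_n).
Variables (F : 'rV[R]_m -> 'rV[R]_n).
Variable G2 : 'rV[R]_n -> 'M[R]_n.
Hypotheses (oU : open U) (sF : smooth_on U F) (UW : forall x, U x -> W (F x)).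
Hypothesis mG2 : metric_field W G2.

Lemma smooth_gamma_along (Y Z : 'rV[R]_m -> 'rV[R]_n) :
  smooth_mx U Y -> smooth_mx U Z ->
  smooth_mx U (fun x => gamma G2 (F x) (Y x) (Z x)).
Proof.
move=> sY sZ a l k; rewrite (ord1 a).
apply: (Ck_on_ext (g := fun x => \sum_i \sum_j
   Y x 0 i * Z x 0 j * christoffel G2 (F x) i j 0 l)) => // [x _|].
  rewrite /gamma summxE; apply: eq_bigr => i _; rewrite summxE.
  by apply: eq_bigr => j _; rewrite [RHS]mxE.
apply: Ck_on_sum => // i; apply: Ck_on_sum => // j; apply: Ck_onM => //.
  by apply: Ck_onM => //; [exact: (sY 0 i k)|exact: (sZ 0 j k)].
exact: (smooth_mx_comp oU UW sF (smooth_christoffel i j mG2)).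
Qed.

Lemma smooth_jacobian : smooth_mx U (jacobian F).
Proof.
move=> i j k; apply: (Ck_on_ext (g := fun x => 'D_(delta_mx 0 i) F x 0 j)) => //.
  by move=> x Ux; rewrite (derive_jacobian sF _ Ux) -rowE mxE.
by apply: smooth_on_mx => //; exact: smooth_derive.
Qed.

End SmoothSff.

Lemma smooth_sff (R : realType) m n (U : set 'rV[R]_m) (W : set 'rV[R]_n)
    (F : 'rV[R]_m -> 'rV[R]_n)
    (G1 : 'rV[R]_m -> 'M[R]_m) (G2 : 'rV[R]_n -> 'M[R]_n) v w :
  open U -> smooth_on U F -> (forall x, U x -> W (F x)) ->
  metric_field U G1 -> metric_field W G2 ->
  smooth_mx U (fun x => sff F G1 G2 x v w).
Proof.
move=> oU sF UW mG1 mG2.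
have sDF b : smooth_mx U ('D_b F).
  by apply: smooth_on_mx => //; exact: smooth_derive.
(* The term [gamma G1] is treated as a Christoffel term along the identity map. *)
have sid : smooth_on U (idfun : 'rV[R]_m -> 'rV[R]_m).
  case=> [|k] /=; first by move=> x _; exact: cvg_id.
  split=> [x _|b]; first by have [dx _] := is_diff_id x; exact: dx.
  rewrite (_ : 'D_b _ = cst b); first exact: Ck_on_cst.
  by apply/funext => x; exact: derive_id.
apply: (smooth_mx_ext oU (B := fun x => 'D_v ('D_w F) x
   + gamma G2 (F x) ('D_v F x) ('D_w F x)
   + - (gamma G1 x v w *m jacobian F x))) => [x _|].
  by rewrite sffE.
apply: smooth_mxD => //; first apply: smooth_mxD => //.
- by apply: smooth_on_mx => //; do 2! apply: smooth_derive.
- by apply: (smooth_gamma_along oU sF UW mG2).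
apply: smooth_mxN => //; apply: smooth_mx_mul => //; last exact: smooth_jacobian.
by apply: (smooth_gamma_along oU sid _ mG1) => //; exact: smooth_mx_cst.
Qed.

(** This quotient is the only possible value of the isotropy function wherever [v] is non-null. *)
Lemma smooth_sff_ratio (R : realType) m n (U : set 'rV[R]_m) (W : set 'rV[R]_n)
    (F : 'rV[R]_m -> 'rV[R]_n)
    (G1 : 'rV[R]_m -> 'M[R]_m) (G2 : 'rV[R]_n -> 'M[R]_n) v :
  open U -> smooth_on U F -> (forall x, U x -> W (F x)) ->
  metric_field U G1 -> metric_field W G2 ->
  (forall x, U x -> inner (G1 x) v v != 0) ->
  smooth_on U (fun x => inner (G2 (F x)) (sff F G1 G2 x v v) (sff F G1 G2 x v v)
    * (inner (G1 x) v v ^+ 2)^-1).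
Proof.
move=> oU sF UW mG1 mG2 v0 k.
have [_ sG1 _ _] := mG1; have [oW sG2 _ _] := mG2.
have ssff := smooth_sff v v oU sF UW mG1 mG2.
have sin : smooth_on U (fun x => inner (G1 x) v v).
  by apply: smooth_inner => //; [exact: smooth_on_mx|exact: smooth_mx_cst..].
apply: Ck_onM => //.
  apply: smooth_inner => //.
  by apply: (smooth_mx_comp oU UW sF); exact: smooth_on_mx.
apply: Ck_onV => // [x Ux|]; first by rewrite expf_neq0// v0.
exact: (Ck_onM oU (sin k) (sin k)).
Qed.

(** * Cubic forms on a Lorentzian plane *)

Lemma mulmx_signature (R : pzRingType) n s :
  let D : 'M[R]_n := diag_mx (\row_j (if (j < s)%N then -1 else 1)) in
  D *m D = 1%:M.
Proof.
rewrite /= mulmx_diag -diag_const_mx; congr diag_mx; apply/rowP => j.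
by rewrite !mxE; case: ifP => _; rewrite ?mulrNN mulr1.
Qed.

(** The signature matrix squares to the identity, so it and its factor [G] are invertible. *)
Lemma form_of_index_unit (R : realType) n s (G : 'M[R]_n) :
  form_of_index s G -> G \in unitmx.
Proof.
move=> [_ [P uP]]; set D := diag_mx _ => E.
have DD : D *m D = 1%:M := mulmx_signature _ _ _.
have uD : D \in unitmx by have [] := mulmx1_unit DD.
by move: uD; rewrite -E !unitmx_mul => /andP[/andP[]].
Qed.

Section LorentzFrame.
Variables (R : realType) (g P : 'M[R]_2).
Hypothesis uP : P \in unitmx.
Hypothesis gP : P *m g *m P^T =
  diag_mx (\row_(j < 2) (if (j < 1)%N then -1 else 1)).

Lemma inner_row i j : inner g (row i P) (row j P) = (P *m g *m P^T) i j.
Proof.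
by rewrite /inner tr_row -row_mul !mxE; apply: eq_bigr => k _; rewrite !mxE.
Qed.

Lemma lorentz_frame : [/\ inner g (row 0 P) (row 0 P) = -1,
  inner g (row 0 P) (row 1 P) = 0, inner g (row 1 P) (row 0 P) = 0
  & inner g (row 1 P) (row 1 P) = 1].
Proof. by split; rewrite inner_row gP !mxE. Qed.

(** Expansion in an orthonormal frame; the first sign comes from [row 0 P] having square [-1]. *)
Lemma lorentz_decomposition v :
  v = - inner g v (row 0 P) *: row 0 P + inner g v (row 1 P) *: row 1 P.
Proof.
have [f00 f01 f10 f11] := lorentz_frame.
have E : v = (v *m invmx P) 0 0 *: row 0 P + (v *m invmx P) 0 1 *: row 1 P.
  rewrite -{1}(mulmxKV uP v) mulmx_sum_row big_ord_recl big_ord1.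
  by rewrite (_ : lift ord0 _ = 1) //; exact/val_inj.
move: E; set a := _ 0 0; set b := _ 0 1 => E.
rewrite [in RHS]E !innerDl !innerZl f00 f01 f10 f11.
by rewrite mulr0 addr0 mulrN1 opprK mulr0 add0r mulr1.
Qed.

End LorentzFrame.

Section CubicForm.
Variables (R : realType) (n : nat) (g1 P : 'M[R]_2) (g2 J : 'M[R]_n).
Variables (T : 'M[R]_(2, n)) (h : 'rV[R]_2 -> 'rV[R]_2 -> 'rV[R]_n).
Hypothesis uP : P \in unitmx.
Hypothesis gP : P *m g1 *m P^T =
  diag_mx (\row_(j < 2) (if (j < 1)%N then -1 else 1)).
Hypothesis g12 : g1 = T *m g2 *m T^T.
Hypothesis J_isometry : forall v w, inner g2 (v *m J) (w *m J) = inner g2 v w.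
Hypothesis normalT : (T *m J == kermx (g2 *m T^T))%MS.
Hypothesis h_normal : forall v w z, inner g2 (h v w) (z *m T) = 0.
Hypothesis h_sym : forall v w, h v w = h w v.
Hypothesis h_linear : forall a v v' w, h (a *: v + v') w = a *: h v w + h v' w.
Let C v w z := inner g2 (h v w) (z *m T *m J).
Hypothesis C_sym : forall v w z, C v w z = C v z w.

Let p0 := row 0 P.
Let p1 := row 1 P.

(** Being normal, [h v w] is the image under [J] of a tangent vector [y]; as [J] is isometric,
    [C v w z] is the product of [y] with [z], which gives the frame coordinates of [y]. *)
Lemma h_expand v w : h v w = (- C v w p0 *: p0 + C v w p1 *: p1) *m T *m J.
Proof.
have /submxP[y yE] : (h v w <= T *m J)%MS.
  rewrite (eqmxP normalT); apply/sub_kermxP/rowP => i.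
  rewrite mulmxA [RHS]mxE -(h_normal v w (delta_mx 0 i)) /inner trmx_mul mulmxA.
  by rewrite trmx_delta -colE [RHS]mxE.
have CE z : C v w z = inner g1 y z.
  by rewrite /C yE mulmxA J_isometry g12 inner_mulmx.
by rewrite !CE -lorentz_decomposition// -mulmxA.
Qed.

Lemma inner_h v w : inner g2 (h v w) (h v w) = - C v w p0 ^+ 2 + C v w p1 ^+ 2.
Proof.
rewrite {1 2}h_expand J_isometry -inner_mulmx -g12.
have [f00 f01 f10 f11] := lorentz_frame gP.
rewrite !innerDl !innerDr !innerZl !innerZr f00 f01 f10 f11.
by ring.
Qed.

Lemma C_linear a v v' w z : C (a *: v + v') w z = a * C v w z + C v' w z.
Proof. by rewrite /C h_linear innerDl innerZl. Qed.

Let c000 := C p0 p0 p0.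
Let c001 := C p0 p0 p1.
Let c011 := C p0 p1 p1.
Let c111 := C p1 p1 p1.

Lemma C_sym12 v w z : C v w z = C w v z.
Proof. by rewrite /C h_sym. Qed.

(** Total symmetry leaves four coefficients of [C] in the frame, and [inner_h] becomes an explicit
    quartic in [x] and [y]. *)
Lemma inner_h_diag x y :
  let v := x *: p0 + y *: p1 in
  inner g2 (h v v) (h v v) =
  - (x ^+ 2 * c000 + 2 * x * y * c001 + y ^+ 2 * c011) ^+ 2
  + (x ^+ 2 * c001 + 2 * x * y * c011 + y ^+ 2 * c111) ^+ 2.
Proof.
move=> v; have Cv w z : C v w z = x * C p0 w z + y * C p1 w z.
  rewrite /v C_linear; congr (_ + _).
  have := C_linear y p1 0 w z; rewrite addr0 => ->.
  have := C_linear 1 0 0 w z; rewrite scale1r addr0 mul1r => E.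
  by rewrite (_ : C 0 w z = 0) ?addr0//; lra.
rewrite inner_h !Cv ![C _ v _]C_sym12 !Cv.
have C010 : C p0 p1 p0 = c001 by exact: C_sym.
have C100 : C p1 p0 p0 = c001 by rewrite C_sym12.
have C101 : C p1 p0 p1 = c011 by exact: C_sym12.
have C110 : C p1 p1 p0 = c011 by rewrite C_sym.
rewrite ?C010 ?C100 ?C101 C110 -/c000 -/c001 -/c011 -/c111.
by ring.
Qed.

Lemma inner_g1_diag x y :
  let v := x *: p0 + y *: p1 in inner g1 v v = y ^+ 2 - x ^+ 2.
Proof.
have [f00 f01 f10 f11] := lorentz_frame gP => v.
rewrite /v !innerDl !innerDr !innerZl !innerZr f00 f01 f10 f11.
by ring.
Qed.

(** By [h_expand], a value of [h] is determined by its two coefficients of [C]. *)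
Lemma h_frame_eq : h p0 p0 = h p1 p1 <-> c000 = c011 /\ c001 = c111.
Proof.
have C110 : C p1 p1 p0 = c011 by rewrite C_sym C_sym12.
split=> [E|[E0 E1]].
  by rewrite /c000 /c001 {1 2}/C E -/(C p1 p1 p0) C110.
by rewrite (h_expand p0 p0) (h_expand p1 p1) C110 -/c000 -/c001 E0 E1.
Qed.

Lemma isotropic_frame (lambda : R) :
  (forall v, inner g2 (h v v) (h v v) = lambda * inner g1 v v ^+ 2) ->
  h p0 p0 = h p1 p1.
Proof.
move=> iso; apply/h_frame_eq.
have E x y : - (x ^+ 2 * c000 + 2 * x * y * c001 + y ^+ 2 * c011) ^+ 2
  + (x ^+ 2 * c001 + 2 * x * y * c011 + y ^+ 2 * c111) ^+ 2 =
  lambda * (y ^+ 2 - x ^+ 2) ^+ 2.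
  by rewrite -inner_h_diag -inner_g1_diag; exact: iso.
(* With the null vectors [e1 = p0 + p1] and [e2 = p1 - p0], the numbers [a], [b], [d], [e] are [C]
   on [(e1, e1, e1)], [(e1, e1, e2)], [(e1, e2, e2)] and [(e2, e2, e2)]. *)
pose a := c000 + 3 * c001 + 3 * c011 + c111.
pose b := c111 + c011 - c001 - c000.
pose d := c000 - c001 - c011 + c111.
pose e := - c000 + 3 * c001 - 3 * c011 + c111.
(* For [v = s e1 + t e2], that is [x = s - t] and [y = s + t], the difference of squares factors as
   [C(v, v, e1) C(v, v, e2)], while [<v, v> = 4 s t]. *)
have E' s t : (a * s ^+ 2 + 2 * b * s * t + d * t ^+ 2) *
    (b * s ^+ 2 + 2 * d * s * t + e * t ^+ 2) = 16 * lambda * s ^+ 2 * t ^+ 2.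
  transitivity (lambda * ((s + t) ^+ 2 - (s - t) ^+ 2) ^+ 2); last by ring.
  by rewrite -E /a /b /d /e; ring.
move: E' => {E}; move: (erefl b) (erefl d); rewrite {2}/b {2}/d.
move: (a) (b) (d) (e) => {}a {}b {}d {}e bE dE E.
(* These six values suffice to compare the coefficients of the two quartics; all but that of
   [s ^ 2 t ^ 2] vanish on the right. *)
have := E 1 0; have := E 0 1; have := E 1 1; have := E 1 (-1).
have := E 1 2; have := E 1 (- 2) => E1 E2 E3 E4 E5 E6.
have ab : a * b = 0 by lra.
have de : d * e = 0 by lra.
have adb : a * d = - b ^+ 2 by lra.
have bed : b * e = - d ^+ 2 by lra.
(* [b ^ 3 = - b (a d) = - (a b) d = 0], and symmetrically for [d]. *)
have b0 : b = 0.
  apply/eqP; have : b ^+ 3 == 0; last by rewrite expf_eq0.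
  by rewrite exprS -[b ^+ 2]opprK -adb mulrN mulrA [b * a]mulrC ab mul0r oppr0.
have d0 : d = 0.
  apply/eqP; have : d ^+ 3 == 0; last by rewrite expf_eq0.
  by rewrite exprS -[d ^+ 2]opprK -bed mulrN mulrCA de mulr0 oppr0.
by split; lra.
Qed.

Lemma frame_isotropic : h p0 p0 = h p1 p1 ->
  exists lambda, forall v,
    inner g2 (h v v) (h v v) = lambda * inner g1 v v ^+ 2.
Proof.
(* The witness is the square of [h p0 p0], as it must be since [p0] has square [-1]. *)
move=> /h_frame_eq[E0 E1]; exists (c001 ^+ 2 - c000 ^+ 2) => v.
have [x [y ->]] : exists x y, v = x *: p0 + y *: p1.
  by eexists; eexists; exact: lorentz_decomposition uP gP v.
rewrite inner_h_diag inner_g1_diag -E0 -E1.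
by ring.
Qed.

Lemma h_sum v w : h v w =
  \sum_i \sum_j (v 0 i * w 0 j) *: h (delta_mx 0 i) (delta_mx 0 j).
Proof.
have h0 w' : h 0 w' = 0.
  have := h_linear 1 0 0 w'; rewrite !scale1r addr0 => E.
  by apply: (addrI (h 0 w')); rewrite addr0 -E.
have hs v' w' : h v' w' = \sum_i v' 0 i *: h (delta_mx 0 i) w'.
  rewrite {1}(row_sum_delta v').
  by elim/big_rec2: _ => [//|i y1 y2 _ IH]; rewrite h_linear IH.
rewrite hs; apply: eq_bigr => i _; rewrite h_sym hs scaler_sumr.
by apply: eq_bigr => j _; rewrite scalerA h_sym.
Qed.

(** The inverse Gram matrix is [P^T *m D *m P], as [D] is its own inverse; the trace is therefore
    the signed sum of [h] over the frame. *)
Lemma trace_frame :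
  \sum_i \sum_j invmx g1 i j *: h (delta_mx 0 i) (delta_mx 0 j) =
  h p1 p1 - h p0 p0.
Proof.
pose D : 'M[R]_2 := diag_mx (\row_(j < 2) (if (j < 1)%N then -1 else 1)).
have PD : P *m g1 *m P^T = D := gP.
have DD : D *m D = 1%:M := mulmx_signature _ _ _.
have uD : D \in unitmx by have [] := mulmx1_unit DD.
have ug1 : g1 \in unitmx.
  by move: uD; rewrite -PD !unitmx_mul => /andP[/andP[]].
have iE : invmx g1 = P^T *m D *m P.
  have E1 : g1 *m (P^T *m D *m P) = 1%:M.
    have : P *m (g1 *m (P^T *m D *m P)) = P.
      by rewrite !mulmxA PD DD mul1mx.
    by move=> E; rewrite -[LHS](mulKmx uP) E mulVmx.
  by rewrite -[RHS](mulKmx ug1) E1 mulmx1.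
transitivity (\sum_k D k k *: h (row k P) (row k P)).
  rewrite iE mul_mx_diag.
  under [RHS]eq_bigr do rewrite h_sum scaler_sumr.
  rewrite [RHS]exchange_big; apply: eq_bigr => i _ /=.
  under [RHS]eq_bigr do rewrite scaler_sumr.
  rewrite [RHS]exchange_big; apply: eq_bigr => j _ /=.
  rewrite mxE scaler_suml; apply: eq_bigr => k _; rewrite scalerA !mxE.
  by congr (_ *: _); rewrite eqxx mulr1n; case: ifP => _; ring.
rewrite big_ord_recl big_ord1 (_ : lift ord0 _ = 1); last exact/val_inj.
by rewrite !mxE !eqxx !mulr1n /= scaleN1r scale1r addrC.
Qed.

End CubicForm.

(** * Charts *)

Lemma metric_field_subset (R : realType) n (U W : set 'rV[R]_n) G :
  open U -> U `<=` W -> metric_field W G -> metric_field U G.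
Proof.
move=> oU UW [_ sG uG symG]; split=> // [k|x /UW/uG //|x /UW/symG //].
exact: Ck_on_subset UW (sG k).
Qed.

Lemma eq_mulmxl (R : pzRingType) m n (A B : 'M[R]_(m, n)) :
  (forall v : 'rV_m, v *m A = v *m B) -> A = B.
Proof. by move=> AB; apply/row_matrixP => i; rewrite !rowE. Qed.

Lemma sff_local (R : realType) m n (U : set 'rV[R]_m)
    (F F' : 'rV[R]_m -> 'rV[R]_n) G1 G2 u v w :
  open U -> (forall x, U x -> F x = F' x) -> U u -> differentiable F u ->
  sff F G1 G2 u v w = sff F' G1 G2 u v w.
Proof.
move=> oU FF' Uu dF.
have dF' : differentiable F' u.
  by apply: near_eq_differentiable dF; exact: (open_near oU Uu).
have DE a x : U x -> 'D_a F x = 'D_a F' x.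
  by move=> Ux; apply: near_eq_derive; exact: (open_near oU Ux).
have DDE : 'D_v ('D_w F) u = 'D_v ('D_w F') u.
  by apply: near_eq_derive; apply: (open_near oU Uu) => x; exact: DE.
have JE : jacobian F u = jacobian F' u.
  apply: eq_mulmxl => a; apply: etrans (deriveEjacobian a dF').
  exact: etrans (esym (deriveEjacobian a dF)) (DE a u Uu).
by rewrite !sffE DDE (DE v _ Uu) (DE w _ Uu) JE (FF' _ Uu).
Qed.

Section Charts.
Variables (R : realType) (M N : topologicalType) (m n : nat).
Variables (c : chart R M m).

Lemma codP u : cod c u -> dom c (param c u) /\ coord c (param c u) = u.
Proof. by move=> [p cp <-]; rewrite coordK. Qed.

(** Inside the open set [cod c], the image of [A] is its preimage under the continuous inverse
    [param c]. *)
Lemma open_coord_image (A : set M) :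
  open A -> A `<=` dom c -> open (coord c @` A).
Proof.
move=> oA Ac; rewrite openE => u [p Ap pu].
have cu : cod c u by exists p => //; exact: Ac.
have [cpu cpuE] := codP cu.
have pE : param c u = p by rewrite -pu coordK//; exact: Ac.
have nA : \forall x \near u, A (param c x).
  apply: (param_continuous cu); rewrite pE; exact: open_nbhs_nbhs.
have nc : \forall x \near u, cod c x.
  by apply: open_nbhs_nbhs; split=> //; exact: cod_open.
apply: filterS2 nA nc => x Ax cx; exists (param c x) => //.
by have [] := codP cx.
Qed.

Variables (f : M -> N) (d : chart R N n).

Lemma repdomP u : repdom f c d u ->
  [/\ cod c u, dom d (f (param c u)) & cod d (rep f c d u)].
Proof.
move=> [p [cp fp] <-]; split; first by exists p.
  by rewrite coordK.
by exists (f p) => //; rewrite /rep coordK.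
Qed.

Lemma repdom_coord p : dom c p -> dom d (f p) -> repdom f c d (coord c p).
Proof. by move=> cp dp; exists p. Qed.

Lemma repdom_open : continuous f -> open (repdom f c d).
Proof.
move=> cf; apply: open_coord_image; last by move=> p [].
apply: openI; first exact: dom_open.
by apply: open_comp; [move=> x _; exact: cf|exact: dom_open].
Qed.

End Charts.

Lemma metric_field_gram (R : realType) n (M : manifold R n) s (g : metric M s)
  c : atlas M c -> metric_field (cod c) (g c).
Proof.
move=> ac; split; first exact: cod_open.
- exact: gram_smooth.
- by move=> x cx; apply: form_of_index_unit; exact: (gram_index g ac cx).
- by move=> x cx; have [] := gram_index g ac cx.
Qed.

Section Transition.
Variables (R : realType) (n : nat) (M : manifold R n) (s : nat) (g : metric M s).
Variables (c d : chart R M n).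
Hypotheses (ac : atlas M c) (ad : atlas M d).

Lemma transition_open : open (repdom (@idfun M) c d).
Proof. by apply: repdom_open => x; exact: cvg_id. Qed.

(** The tensor law of the metric says that a transition map is a local isometry. *)
Lemma sff_transition u v w : repdom (@idfun M) c d u ->
  sff (rep (@idfun M) c d) (g c) (g d) u v w = 0.
Proof.
move=> du; have oU := transition_open.
apply: (@sff_local_isometry R n (repdom (@idfun M) c d) (cod d)) => //.
- exact: atlas_compatible.
- by move=> x /repdomP[].
- apply: metric_field_subset oU _ (metric_field_gram g ac).
  by move=> x /repdomP[].
- exact: metric_field_gram.
- by move=> x; exact: gram_tensor.
Qed.

End Transition.

(** * Independence of the charts *)

Section Invariance.
Variables (R : realType) (m n s t : nat).
Variables (M : manifold R m) (gM : metric M s) (N : manifold R n) (g : metric N t).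
Variables (f : M -> N) (hf : smooth_map f).
Variables (c c' : chart R M m) (d d' : chart R N n).
Hypotheses (ac : atlas M c) (ac' : atlas M c') (ad : atlas N d) (ad' : atlas N d').

Let phi := rep (@idfun M) c c'.
Let psi := rep (@idfun N) d d'.
Let F := rep f c d.
Let F' := rep f c' d'.

(** On the common domain [F' \o phi = psi \o F]. Both sides are expanded by [sff_comp], where the
    second fundamental forms of the transition maps [phi] and [psi] vanish. *)
Lemma second_fundamental_form_chart p v w :
  dom c p -> dom c' p -> dom d (f p) -> dom d' (f p) ->
  let u := coord c p in
  second_fundamental_form gM g f c' d' (coord c' p)
    (v *m jacobian phi u) (w *m jacobian phi u) =
  second_fundamental_form gM g f c d u v w *m jacobian psi (F u).
Proof.
move=> cp c'p dp d'p u; have [cf sf] := hf.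
pose U : set 'rV[R]_m :=
  coord c @` ((dom c `&` dom c') `&` f @^-1` (dom d `&` dom d')).
have oU : open U.
  apply: open_coord_image; last by move=> q [[]].
  apply: openI; first by apply: openI; exact: dom_open.
  apply: open_comp; first by move=> x _; exact: cf.
  by apply: openI; exact: dom_open.
have Uu : U u by exists p.
have sphi : smooth_on U phi.
  move=> k; apply: Ck_on_subset (atlas_compatible ac ac' k) => x [q [[? ?] _] <-].
  exact: repdom_coord.
have sF : smooth_on U F.
  move=> k; apply: Ck_on_subset (sf c d ac ad k) => x [q [[? ?] [? ?]] <-].
  exact: repdom_coord.
have sF' := sf c' d' ac' ad'.
have spsi := atlas_compatible ad ad'.
have UF x : U x -> repdom (@idfun N) d d' (F x).
  by move=> [q [[? ?] [? ?]] <-]; rewrite /F /rep coordK//; exact: repdom_coord.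
have Uphi x : U x -> repdom f c' d' (phi x).
  by move=> [q [[? ?] [? ?]] <-]; rewrite /phi /rep coordK//; exact: repdom_coord.
have E x : U x -> (F' \o phi) x = (psi \o F) x.
  move=> [q [[? ?] [? ?]] <-].
  by rewrite /F' /phi /psi /F /rep /= !coordK.
have oF' : open (repdom f c' d') by exact: repdom_open.
have sffE1 := sff_comp oU sphi oF' sF' Uphi (gM c) (gM c') (g d') v w Uu.
have sffE2 := sff_comp oU sF (transition_open (c := d) (d := d')) spsi UF
  (gM c) (g d) (g d') v w Uu.
have phiu : phi u = coord c' p by rewrite /phi /rep coordK.
have ru : repdom (@idfun M) c c' u by exact: repdom_coord.
rewrite (sff_transition gM ac ac')// mul0mx addr0 in sffE1.
rewrite (sff_transition g ad ad') ?add0r in sffE2; last exact: UF.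
rewrite -[RHS]/(sff F (gM c) (g d) u v w *m jacobian psi (F u)) -sffE2.
rewrite -[LHS]/(sff F' (gM c') (g d') _ _ _) -phiu.
rewrite -!(derive_jacobian sphi _ Uu) -sffE1.
have dF'phi : differentiable (F' \o phi) u.
  apply: differentiable_comp; first exact: smooth_differentiable sphi Uu.
  exact: smooth_differentiable sF' (Uphi _ Uu).
exact: sff_local oU E Uu dF'phi.
Qed.

End Invariance.

(** * Lagrangian Lorentzian surfaces *)

Section LagrangianSurface.
Variables (R : realType) (n t : nat) (M : manifold R 2) (gM : metric M 1).
Variables (N : manifold R n) (g : metric N t) (J : kahler g) (f : M -> N).
Hypotheses (hf : isometric_immersion gM g f) (hL : lagrangian J f).

(** The algebra of cubic forms applies at [u] in an orthonormal frame: both conditions amount to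
    [h p0 p0 = h p1 p1]. *)
Lemma pointwise_isotropic_minimal c d u :
  atlas M c -> atlas N d -> repdom f c d u ->
  let h := second_fundamental_form gM g f c d u in
  (exists lambda, forall v, inner (g d (rep f c d u)) (h v v) (h v v)
     = lambda * inner (gM c u) v v ^+ 2) <->
  \sum_i \sum_j invmx (gM c u) i j *: h (delta_mx 0 i) (delta_mx 0 j) = 0.
Proof.
move=> ac ad du h; have [[cf sf] iso] := hf.
pose F := rep f c d; pose U := repdom f c d.
have oU : open U by exact: repdom_open.
have sF : smooth_on U F by exact: sf.
have UW x : U x -> cod d (F x) by move=> /repdomP[].
have mG1 : metric_field U (gM c).
  by apply: metric_field_subset oU _ (metric_field_gram gM ac) => x /repdomP[].
have mG2 := metric_field_gram g ad.
have isoF x : U x -> gM c x = jacobian F x *m g d (F x) *m (jacobian F x)^T.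
  by move=> Ux; have [_] := iso c d x ac ad Ux.
have lagF x : U x -> forall w z, inner (g d (F x)) (w *m jacobian F x)
    (z *m jacobian F x *m J d (F x)) = 0.
  move=> Ux w z; have [+ _] := hL ac ad Ux; rewrite -/F => /eqmxP TJ.
  have [_ _ _ symG] := mG2.
  have /sub_kermxP E : (z *m (jacobian F x *m J d (F x)) <=
      kermx (g d (F x) *m (jacobian F x)^T))%MS.
    by rewrite -TJ submxMl.
  rewrite inner_sym; last exact/symG/UW.
  rewrite /inner trmx_mul; set A := _ *m _ *m _.
  have -> : A = z *m (jacobian F x *m J d (F x)) *m
      (g d (F x) *m (jacobian F x)^T) *m w^T by rewrite /A !mulmxA.
  by rewrite E mul0mx mxE.
have Wu := UW _ du.
have [_ [P uP gP]] := gram_index gM ac (let: And3 a _ _ := repdomP du in a).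
have Jiso := cplx_isometry J ad Wu.
have [normalT _] := hL ac ad du.
have hN v w z := gauss_formula oU sF UW mG1 mG2 isoF v w z du.
have hS v w : h v w = h w v := sff_sym oU sF UW mG1 mG2 v w du.
have hlin a v v' w : h (a *: v + v') w = a *: h v w + h v' w :=
  sff_linearl (gM c) (g d) sF a v v' w du.
have hC v w z : inner (g d (F u)) (h v w) (z *m jacobian F u *m J d (F u)) =
    inner (g d (F u)) (h v z) (w *m jacobian F u *m J d (F u)).
  have sJ : smooth_on (cod d) (J d) by exact: cplx_smooth.
  exact: (cubic_sym23 (gM c) oU sF UW mG2 sJ
    (fun y => @cplx_square _ _ _ _ _ J d y ad)
    (fun y => @cplx_isometry _ _ _ _ _ J d y ad)
    (fun y => @cplx_parallel _ _ _ _ _ J d y ad) lagF v w z du).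
have tr := trace_frame uP gP hS hlin.
rewrite -/h in tr.
split=> [[lambda isoh]|].
  have E := isotropic_frame uP gP (isoF _ du) Jiso normalT hN hS hlin hC isoh.
  by rewrite tr; apply/eqP; rewrite subr_eq0 eq_sym; apply/eqP; exact: E.
rewrite tr => /eqP; rewrite subr_eq0 eq_sym => /eqP E.
exact: frame_isotropic uP gP (isoF _ du) Jiso normalT hN hS hlin hC E.
Qed.

Lemma isotropic_chart (lambda : R) c c' d d' p :
  atlas M c -> atlas M c' -> atlas N d -> atlas N d' ->
  dom c p -> dom c' p -> dom d (f p) -> dom d' (f p) ->
  (forall v, let h := second_fundamental_form gM g f c d (coord c p) v v in
     inner (g d (rep f c d (coord c p))) h h =
     lambda * inner (gM c (coord c p)) v v ^+ 2) ->
  forall v, let h := second_fundamental_form gM g f c' d' (coord c' p) v v in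
     inner (g d' (rep f c' d' (coord c' p))) h h =
     lambda * inner (gM c' (coord c' p)) v v ^+ 2.
Proof.
move=> ac ac' ad ad' cp c'p dp d'p iso v' /=; have [smf _] := hf.
pose u := coord c p; pose phi := rep (@idfun M) c c'.
pose psi := rep (@idfun N) d d'; pose y := rep f c d u.
have cu : cod c u by exists p.
have ru : repdom (@idfun M) c c' u by exact: repdom_coord.
have ry : repdom (@idfun N) d d' y.
  by rewrite /y /rep coordK//; exact: repdom_coord.
have gramM : gM c u = jacobian phi u *m gM c' (phi u) *m (jacobian phi u)^T.
  exact: gram_tensor.
have gramN : g d y = jacobian psi y *m g d' (psi y) *m (jacobian psi y)^T.
  exact: gram_tensor.
have uphi := isometry_unitmx (form_of_index_unit (gram_index gM ac cu)) gramM.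
have phiu : phi u = coord c' p by rewrite /phi /rep coordK.
have psiy : psi y = rep f c' d' (coord c' p) by rewrite /psi /y /rep !coordK.
(* The Jacobian of [phi] being invertible, every vector in the chart [c'] comes from a vector [v] in
   the chart [c]. *)
rewrite -(mulmxKV uphi v'); move: (v' *m _) => v.
rewrite (second_fundamental_form_chart gM g smf ac ac' ad ad')//.
by rewrite -psiy -inner_mulmx -gramN iso -phiu -inner_mulmx -gramM.
Qed.

Lemma nonnull_vector c u : atlas M c -> cod c u ->
  exists v, inner (gM c u) v v != 0.
Proof.
move=> ac cu; have [_ [P uP gP]] := gram_index gM ac cu.
have [_ _ _ f11] := lorentz_frame gP.
by exists (row 1 P); rewrite f11 oner_neq0.
Qed.

Lemma isotropic_minimal : pseudo_isotropic gM g f -> minimal gM g f.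
Proof.
move=> [lambda _ iso] c d u ac ad du.
apply/(pointwise_isotropic_minimal ac ad du).
by exists (lambda (param c u)) => v; exact: iso.
Qed.

Lemma minimal_isotropic : minimal gM g f -> pseudo_isotropic gM g f.
Proof.
move=> minf; have [smf _] := hf; have [cf sf] := smf.
(* Quantifying over all charts around [p] and [f p] lets the chosen function be computed in any of
   them. *)
pose is_lambda (p : M) (l : R) := forall c d, atlas M c -> atlas N d ->
  dom c p -> dom d (f p) -> forall v,
  let h := second_fundamental_form gM g f c d (coord c p) v v in
  inner (g d (rep f c d (coord c p))) h h =
  l * inner (gM c (coord c p)) v v ^+ 2.
have /choice[lambda lambdaE] : forall p, exists l, is_lambda p l.
  move=> p; have [c ac cp] := atlas_cover p; have [d ad dp] := atlas_cover (f p).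
  have rp := repdom_coord cp dp.
  have /(pointwise_isotropic_minimal ac ad rp)[l lE] := minf c d _ ac ad rp.
  exists l => c' d' ac' ad' c'p d'p.
  exact: (isotropic_chart ac ac' ad ad' cp c'p dp d'p lE).
have iso c d u : atlas M c -> atlas N d -> repdom f c d u -> forall v,
    let h := second_fundamental_form gM g f c d u v v in
    inner (g d (rep f c d u)) h h =
    lambda (param c u) * inner (gM c u) v v ^+ 2.
  move=> ac ad [p [cp dp] <-] v; rewrite coordK//; exact: lambdaE.
exists lambda => // c ac k; apply: Ck_on_local => u cu.
have [cp pE] := codP cu; have [d ad dp] := atlas_cover (f (param c u)).
have [v v0] := nonnull_vector ac cu.
have oU : open (repdom f c d) by exact: repdom_open.
have mG2 := metric_field_gram g ad.
(* On [A] the fixed vector [v] stays non-null, so dividing the isotropy identity for [v] recovers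
   [lambda]. *)
pose A : set 'rV[R]_2 := repdom f c d `&` [set x | inner (gM c x) v v != 0].
have oA : open A.
  rewrite openE => x [Ux x0]; have [cx _ _] := repdomP Ux.
  have [oc sg _ _] := metric_field_gram gM ac.
  have sq : smooth_on (cod c) (fun x => inner (gM c x) v v).
    by apply: smooth_inner => //; [exact: smooth_on_mx|exact: smooth_mx_cst..].
  have cq : inner (gM c y) v v @[y --> x] --> inner (gM c x) v v := sq 0%N x cx.
  have nU : \forall y \near x, repdom f c d y by exact: open_nbhs_nbhs.
  by apply: filterI nU _; exact: (cvgr_neq0 _ cq).
have UA : A `<=` cod c by move=> x [/repdomP[]].
have mG1 := metric_field_subset oA UA (metric_field_gram gM ac).
have sF : smooth_on A (rep f c d).
  by move=> j; apply: Ck_on_subset (sf c d ac ad j) => x [].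
have AW x : A x -> cod d (rep f c d x) by move=> [/repdomP[]].
have A0 x : A x -> inner (gM c x) v v != 0 by case.
have Au : A u by split=> //; rewrite -pE; exact: repdom_coord.
(* The function left open is set by the next line to the quotient of [smooth_sff_ratio]. *)
eexists A, _; split; [exact: oA|exact: Au| |].
  exact: (smooth_sff_ratio oA sF AW mG1 mG2 A0 k).
move=> x Ax; have [Ux x0] := Ax.
rewrite -[sff _ _ _ _ _ _]/(second_fundamental_form gM g f c d x v v).
by rewrite (iso c d x ac ad Ux) mulfK// expf_neq0.
Qed.

End LagrangianSurface.

Theorem theorem1p1 (R : realType) (c : R)
  (N : complex_pseudo_space_form 2 1 (4 * c))
  (M : manifold R 2) (gM : metric M 1) (f : M -> N)
  (hf : isometric_immersion gM (csf_metric N) f)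
  (hL : lagrangian (csf_cplx N) f) :
  pseudo_isotropic gM (csf_metric N) f <-> minimal gM (csf_metric N) f.
Proof.
split; first exact: isotropic_minimal hf hL.
exact: minimal_isotropic hf hL.
Qed.
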